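(* Consider the fully dynamic matching model with $m$ supply units in dimension $d=1$ (see context). There exists a constant $\epsilon>0$ such that for all $m\ge 2$, any horizon $N\ge m^2$, arbitrary initial locations of the $m$ supply units, and any policy, the expected average cost per period over the $N$ periods is at least $\epsilon\,\dfrac{\log m}{m}$.
   Context: Fully dynamic model: initially there are $m$ supply units at arbitrary locations in $[0,1]^d$. In each period $t=1,2,\dots,N$: (1) a demand unit arrives at a uniformly random location in $[0,1]^d$, independent of the past, and must be matched immediately; (2) the policy chooses one of the $m$ supply units currently in the system to match it to, the matched pair leaves, and the period cost is the Euclidean distance between the demand unit and the matched supply unit; (3) a new supply unit arrives at a uniformly random location in $[0,1]^d$, independent of the past, restoring the number of supply units to $m$. A policy is non-anticipating: its choice in period $t$ may depend on the initial locations, all arrivals up to and including the period-$t$ demand arrival, past decisions, and possibly independent randomization, but not on future arrivals. *)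

(* Defs.v *)
From HB Require Import structures.
From mathcomp Require Import all_boot all_order all_algebra.
From mathcomp Require Import all_classical all_reals all_analysis.

Set Implicit Arguments.
Unset Strict Implicit.
Unset Printing Implicit Defensive.

Import Order.TTheory GRing.Theory Num.Theory.
Import numFieldNormedType.Exports.

Local Open Scope classical_set_scope.
Local Open Scope ring_scope.

(* Conventions: dimension one, so locations are reals in [0, 1] and the
   Euclidean distance is `|x - y|. Periods are numbered from 0. The m supply
   units present in the system occupy slots indexed by 'I_m; the unit arriving
   at the end of a period takes the slot freed by the match of that period, so
   choosing a supply unit amounts to choosing a slot. *)

(* [match_choice pi u x0 ds ss h] is the slot matched in period t, given the
   randomization seed u, the initial locations x0, the demand locations ds of
   periods 0 .. t, the supply arrivals ss of periods 0 .. t-1, and the past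
   decisions h. The decisions range over a finite set, so measurability is
   required for each fixed h; it is also only required for each fixed x0,
   since the initial locations are deterministic. A deterministic policy is
   one that ignores u. *)
Record policy (dU : measure_display) (U : measurableType dU) (R : realType)
    (m : nat) := Policy {
  match_choice : forall t : nat,
    U -> ('I_m -> R) -> t.+1.-tuple R -> t.-tuple R -> t.-tuple 'I_m -> 'I_m ;
  measurable_match_choice : forall (t : nat) (x0 : 'I_m -> R) (h : t.-tuple 'I_m)
      (i : 'I_m),
    measurable [set z : U * (t.+1.-tuple R * t.-tuple R) |
                 match_choice z.1 x0 z.2.1 z.2.2 h = i]
}.

Section dynamics.
Context (dU : measure_display) (U : measurableType dU) (R : realType) (m : nat).
Variables (pi : policy U R m) (u : U) (x0 : 'I_m -> R)
  (demand arrival : nat -> R).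

Definition decide (t : nat) (h : t.-tuple 'I_m) : 'I_m :=
  match_choice pi u x0 [tuple demand i | i < t.+1] [tuple arrival i | i < t] h.

Fixpoint past_decisions (t : nat) : t.-tuple 'I_m :=
  match t with
  | 0 => [tuple]
  | s.+1 => [tuple of rcons (past_decisions s) (decide (past_decisions s))]
  end.

Definition decision (t : nat) : 'I_m := decide (past_decisions t).

Fixpoint supply_locations (t : nat) : 'I_m -> R :=
  match t with
  | 0 => x0
  | s.+1 => fun i => if i == decision s then arrival s else supply_locations s i
  end.

Definition period_cost (t : nat) : R :=
  `|demand t - supply_locations t (decision t)|.

Definition average_cost (N : nat) : R :=
  (\sum_(t < N) period_cost t) / N%:R.

End dynamics.

Section arrivals.
Context (d : measure_display) (Omega : measurableType d) (R : realType).
Variable P : probability Omega R.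

Definition mutually_independent (I : finType) (F : I -> set (set Omega)) :=
  forall (J : {set I}) (A : I -> set Omega),
    (forall j, j \in J -> F j (A j)) ->
    P (\bigcap_(j in [set` J]) A j) = (\prod_(j in J) P (A j))%E.

Definition uniform01 (X : {RV P >-> R}) :=
  forall A : set R, measurable A ->
    distribution P X A = uniform_prob (@ltr01 R) A.

(* The sigma-algebras of the seed, of the demands and of the supply arrivals
   of the first N periods. *)
Definition source_events (dU : measure_display) (U : measurableType dU)
    (N : nat) (W : {RV P >-> U}) (D S : nat -> {RV P >-> R})
    (j : option ('I_N + 'I_N)) : set (set Omega) :=
  match j with
  | None => preimage_set_system setT W measurable
  | Some (inl t) => preimage_set_system setT (D t) measurable
  | Some (inr t) => preimage_set_system setT (S t) measurable
  end.

Definition fully_dynamic_arrivals (dU : measure_display)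
    (U : measurableType dU) (N : nat) (W : {RV P >-> U})
    (D S : nat -> {RV P >-> R}) :=
  [/\ forall t, (t < N)%N -> uniform01 (D t),
      forall t, (t < N)%N -> uniform01 (S t) &
      mutually_independent (source_events (N := N) W D S)].

End arrivals.

(* Main.v *)
Require Import Defs.
From HB Require Import structures.
From mathcomp Require Import all_boot all_order all_algebra.
From mathcomp Require Import all_classical all_reals all_analysis.
From mathcomp Require Import measurable_realfun ring lra zify.

(** Cut [0, 1] into cells and let [F x] be the number of supply units in the
    first [x] cells. A demand in cell [i] and an arrival in cell [j] add
    [step j - step i] to [F], and a match of cost [c] then moves [F] by at most
    [n * c + 1] in l1 norm, [n] being the number of cells.

    For [n = m], take as potential [Phi F] the minimum over profiles [f] of a
    logarithmic energy of the increments of [f] (a discrete H^(1/2) norm of [f])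
    plus [64 * |F - f|_1]. It is 64-Lipschitz in l1 norm, so matches decrease it
    by at most a constant times [n * c + 1]. On the other hand its mean increase
    under the arrivals is of order [ln m] in every state. Indeed the gradient of
    the energy at the minimizer [f] is the discrete Hilbert transform of the
    increments of [f]; these are nonnegative by a maximum principle, so by the
    weak type (1,1) inequality the gradient is at most 32, half the slope of the
    penalty, outside a small fraction of the cells. Around a typical cell [f] is
    therefore free to react, and the jump produced by an arrival costs its
    logarithmic energy. Since [Phi] varies by [O(m^2)] at most, summing over
    [N >= m^2] periods gives the bound for large [m]; for bounded [m] it is
    enough that a demand is often far from all supply units. *)

Set Implicit Arguments.
Unset Strict Implicit.
Unset Printing Implicit Defensive.

Import Order.TTheory GRing.Theory Num.Theory.
Import numFieldNormedType.Exports.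

Local Open Scope classical_set_scope.
Local Open Scope ring_scope.

(** * The discrete Hilbert transform *)

Section kernel.
Context {R : realFieldType}.
Implicit Types (x y j n : nat) (f p : nat -> R).

(** Cauchy kernel between the integer [x] and the midpoint of the edge from [j] to [j.+1]; the half
    shift keeps it nonsingular. *)
Definition cau x j : R := (x%:R - j%:R - 2^-1)^-1.

Lemma cauSS x j : cau x.+1 j.+1 = cau x j.
Proof. by rewrite /cau; congr (_^-1); rewrite -(natr1 x) -(natr1 j); ring. Qed.

Lemma cau_den_gt0 x j : (j < x)%N -> 0 < x%:R - j%:R - 2^-1 :> R.
Proof.
by move=> jx; have : j.+1%:R <= x%:R :> R; [rewrite ler_nat | rewrite -natr1; lra].
Qed.

Lemma cau_den_lt0 x j : (x <= j)%N -> x%:R - j%:R - 2^-1 < 0 :> R.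
Proof. by move=> jx; have : x%:R <= j%:R :> R; [rewrite ler_nat | lra]. Qed.

Lemma cau_gt0 x j : (j < x)%N -> 0 < cau x j.
Proof. by move=> jx; rewrite invr_gt0 cau_den_gt0. Qed.

Lemma cau_lt0 x j : (x <= j)%N -> cau x j < 0.
Proof. by move=> jx; rewrite invr_lt0 cau_den_lt0. Qed.

Lemma cau_den_neq0 x j : x%:R - j%:R - 2^-1 != 0 :> R.
Proof.
by case: (ltnP j x) => [/cau_den_gt0/lt0r_neq0|/cau_den_lt0/ltr0_neq0].
Qed.

Lemma cau_flip n x j : (x <= n)%N -> (j < n)%N ->
  cau (n - x) (n - j.+1) = - cau x j.
Proof.
by move=> xn jn; rewrite /cau !natrB // -(natr1 j); apply: invr_inj; rewrite invrN !invrK; lra.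
Qed.

(** A discrete kernel of the H^(1/2) seminorm: positive off the diagonal, - 4 on it, with negative
    row sums over [0, n) when x < n. *)
Definition kap x y : R := cau x y - cau x.+1 y.

Lemma kapE x y : kap x y = ((x%:R - y%:R) ^+ 2 - 4^-1)^-1.
Proof.
have := cau_den_neq0 x.+1 y; have := cau_den_neq0 x y; rewrite /kap /cau -(natr1 x).
have -> : (x%:R - y%:R) ^+ 2 - 4^-1 =
  (x%:R - y%:R - 2^-1) * (x%:R - y%:R - 2^-1 + 1) :> R by field.
have -> : x%:R + 1 - y%:R - 2^-1 = x%:R - y%:R - 2^-1 + 1 :> R by ring.
by move: (_ - _ - _) => a a0 a1; field; rewrite a0 a1.
Qed.

Lemma kapC x y : kap x y = kap y x.
Proof. by rewrite !kapE -sqrrN opprB. Qed.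

Lemma kapxx x : kap x x = - 4.
Proof. by rewrite kapE subrr expr0n /= sub0r invrN invrK. Qed.

Lemma sum_kap x n : \sum_(j < n) kap x j = cau x.+1 n - cau x.+1 0.
Proof.
elim: n => [|n IH]; first by rewrite big_ord0 subrr.
by rewrite big_ord_recr /= IH /kap cauSS; ring.
Qed.

Lemma kap_ge x y t : x != y -> (x <= y + t)%N -> (y <= x + t)%N ->
  (t%:R ^+ 2)^-1 <= kap x y.
Proof.
move=> xy xt yt; rewrite kapE.
have d1 : 1 <= (x%:R - y%:R) ^+ 2 :> R.
  have [lt|lt|eq] := ltngtP x y; last by rewrite eq eqxx in xy.
  - by have : x.+1%:R <= y%:R :> R; [rewrite ler_nat | rewrite -natr1; nra].
  - by have : y.+1%:R <= x%:R :> R; [rewrite ler_nat | rewrite -natr1; nra].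
have d2 : (x%:R - y%:R) ^+ 2 <= t%:R ^+ 2 :> R.
  have : x%:R <= (y + t)%:R :> R by rewrite ler_nat.
  have : y%:R <= (x + t)%:R :> R by rewrite ler_nat.
  by rewrite !natrD; nra.
by rewrite lef_pV2 ?posrE; lra.
Qed.

Lemma kap_gt0 x y : x != y -> 0 < kap x y.
Proof.
move=> xy; apply: (lt_le_trans _ (@kap_ge x y (x + y) xy _ _)); last 2 first.
- by lia.
- by lia.
by rewrite invr_gt0 exprn_gt0 // ltr0n; lia.
Qed.

Lemma kap_sqr_ge0 f x y : 0 <= kap x y * (f x - f y) ^+ 2.
Proof.
have [->|xy] := eqVneq x y; first by rewrite subrr expr0n /= mulr0.
by rewrite mulr_ge0 ?sqr_ge0 // ltW // kap_gt0.
Qed.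

(* The Hilbert transform, at the integer [x], of the increments of [f] placed
   at half-integers. *)
Definition hil n f x : R := \sum_(j < n) (f j.+1 - f j) * cau x j.

(** Summation by parts: with values of [f] weighted by [kap], the sign of [hil] can be read off
    where [f] is extremal. *)
Lemma hil_abel n f x :
  hil n f x = f n * cau x.+1 n - f 0 * cau x.+1 0 - \sum_(j < n) f j * kap x j.
Proof.
rewrite /hil; elim: n => [|n IH]; first by rewrite !big_ord0; ring.
by rewrite !big_ord_recr /= IH /kap cauSS; ring.
Qed.

Lemma hil_succ n f x :
  hil n f x.+1 - hil n f x = - \sum_(j < n) (f j.+1 - f j) * kap x j.
Proof.
rewrite /hil -sumrB -sumrN; apply: eq_bigr => j _; rewrite /kap; ring.
Qed.

(* The weights are the residues of [\prod_(z in X) (y - z + 1/2) / (y - z)],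
   which takes nonnegative values at half-integers; its partial fraction
   expansion there is [1 - \sum_(z in X) w z * cau z j]. *)
Lemma boole_weights (X : seq nat) : sorted (fun a b => b < a)%N X ->
  exists w : nat -> R, [/\ forall z, z \in X -> 0 <= w z,
    \sum_(z <- X) w z = (size X)%:R / 2 &
    forall j, \sum_(z <- X) w z * cau z j <= 1].
Proof.
elim: X => [|x X IH] /=.
  by move=> _; exists (fun=> 0); split => [//||j]; rewrite !big_nil ?mul0r ?ler01.
rewrite path_sortedE; last by move=> a b c; lia.
case/andP => /allP xX /IH[w [w0 ws wj]].
have den z : z \in X -> 1 <= x%:R - z%:R :> R.
  by move=> /xX zx; have : z.+1%:R <= x%:R :> R; [rewrite ler_nat | rewrite -natr1; lra].
(* The head [x] is the largest point and multiplies the product by 1 + (1/2) / (y - x). The residue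
   at [x] is half the old product at [x], that is [(1 + s) / 2]; an old residue at [z] is multiplied
   by the new factor at [z]. *)
pose s := \sum_(z <- X) w z / (x%:R - z%:R).
pose w' z := if z == x then (1 + s) / 2 else w z * (1 - 2^-1 / (x%:R - z%:R)).
have w'x : w' x = (1 + s) / 2 by rewrite /w' eqxx.
have w'X z : z \in X -> w' z = w z * (1 - 2^-1 / (x%:R - z%:R)).
  by move=> /xX zx; rewrite /w' ifF //; lia.
have s0 : 0 <= s.
  rewrite /s big_seq sumr_ge0 // => z zX; rewrite divr_ge0 ?w0 //.
  by have := den _ zX; lra.
exists w'; split.
- move=> z; rewrite inE => /orP[/eqP->|zX]; first by rewrite w'x divr_ge0 // addr_ge0.
  rewrite w'X // mulr_ge0 ?w0 // subr_ge0 ler_pdivrMr; have := den _ zX; lra.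
- rewrite big_cons w'x big_seq; under eq_bigr => z zX do rewrite w'X // mulrBr mulr1.
  rewrite -big_seq sumrB ws.
  have -> : \sum_(z <- X) w z * (2^-1 / (x%:R - z%:R)) = s / 2.
    by rewrite /s mulr_suml; apply: eq_bigr => z _; ring.
  by rewrite /= -natr1; field.
- move=> j; rewrite big_cons w'x big_seq.
  have E z : z \in X -> w' z * cau z j =
      w z * cau z j * (1 - cau x j / 2) - w z / (x%:R - z%:R) * (cau x j / 2).
    move=> zX; rewrite w'X // /cau.
    have := cau_den_neq0 x j; have := cau_den_neq0 z j; have := den _ zX.
    have -> : x%:R - z%:R = (x%:R - j%:R - 2^-1) - (z%:R - j%:R - 2^-1) :> R by ring.
    move: (x%:R - _ - _) (z%:R - _ - _) => a b h1 b0 a0.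
    by field; rewrite a0 b0 andbT; apply: lt0r_neq0; lra.
  rewrite (eq_bigr _ E) -big_seq sumrB -!mulr_suml -/s.
  (* The new factor at y = j + 1/2. *)
  have c1 : 0 <= 1 - cau x j / 2.
    have [xj|jx] := leqP x j; first by have := cau_lt0 xj; lra.
    have : cau x j <= 2.
      rewrite /cau -[leRHS]invrK lef_pV2 ?posrE ?invr_gt0 ?ltr0n ?cau_den_gt0 //.
      by have : j.+1%:R <= x%:R :> R; [rewrite ler_nat | rewrite -natr1; lra].
    by lra.
  have := wj j; set S := \sum_(z <- X) _ => S1; nra.
Qed.

(** Sum the lower bounds against the weights of [boole_weights]: after exchanging sums each [p j]
    has coefficient at most 1, while the weights add up to half the size of [X]. *)
Lemma boole_ineq n p (X : seq nat) (l : R) : (forall j, (j < n)%N -> 0 <= p j) ->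
  sorted (fun a b => b < a)%N X ->
  (forall z, z \in X -> l <= \sum_(j < n) p j * cau z j) ->
  l * (size X)%:R <= 2 * \sum_(j < n) p j.
Proof.
move=> p0 /boole_weights[w [w0 ws wj]] lX.
have : l * (\sum_(z <- X) w z) <= \sum_(j < n) p j.
  apply: (@le_trans _ _ (\sum_(z <- X) w z * \sum_(j < n) p j * cau z j)).
    rewrite mulr_sumr big_seq [leRHS]big_seq; apply: ler_sum => z zX.
    by rewrite mulrC; apply: ler_wpM2l; [exact: w0 | exact: lX].
  under eq_bigr do rewrite mulr_sumr.
  rewrite exchange_big /=; apply: ler_sum => j _.
  under eq_bigr do rewrite mulrCA.
  by rewrite -mulr_sumr ler_piMr ?p0.
by rewrite ws; lra.
Qed.

(** Reflection reverses the sign of the kernel, so in [boole_count] the lower tail reduces to the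
    upper one. *)
Lemma hil_flip n p x : (x <= n)%N ->
  \sum_(j < n) p (n - j.+1)%N * cau (n - x) j = - \sum_(j < n) p j * cau x j.
Proof.
move=> xn; rewrite (reindex_inj rev_ord_inj) /= -sumrN.
apply: eq_bigr => j _; rewrite cau_flip // mulrN subnSK // subKn //.
exact: ltnW.
Qed.

(* The weak type (1,1) inequality for the Hilbert transform of a positive
   measure, in the discrete form of Boole's identity. *)
Lemma boole_count n p (l : R) : 0 < l -> (forall j, (j < n)%N -> 0 <= p j) ->
  l * (count (fun x => l < `|\sum_(j < n) p j * cau x j|) (iota 0 n))%:R
    <= 4 * \sum_(j < n) p j.
Proof.
move=> l0 p0; pose H x := \sum_(j < n) p j * cau x j.
rewrite -[count _ _]/(count (fun x => l < `|H x|) (iota 0 n)).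
have ub1 : l * (count (fun x => l < H x) (iota 0 n))%:R <= 2 * \sum_(j < n) p j.
  rewrite -size_filter -size_rev; apply: boole_ineq => //.
  - rewrite rev_sorted; apply: sorted_filter; first by move=> a b c; lia.
    exact: iota_ltn_sorted.
  - by move=> z; rewrite mem_rev mem_filter => /andP[/ltW].
have ub2 : l * (count (fun x => l < - H x) (iota 0 n))%:R <= 2 * \sum_(j < n) p j.
  pose X := [seq (n - x)%N | x <- [seq x <- iota 0 n | l < - H x]].
  have -> : \sum_(j < n) p j = \sum_(j < n) p (n - j.+1)%N.
    rewrite [RHS](reindex_inj rev_ord_inj) /=; apply: eq_bigr => j _.
    by rewrite subnSK // subKn // ltnW.
  rewrite -size_filter -(size_map (subn n)); apply: (@boole_ineq n (fun j => p (n - j.+1)%N) X).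
  - by move=> j jn; apply: p0; lia.
  - rewrite sorted_map; apply: (@sub_in_sorted _ (fun x => x < n)%N ltn) => /=.
    + by move=> a b; rewrite -!topredE /= => an bn; lia.
    + by apply/allP => x; rewrite mem_filter mem_iota; lia.
    + apply: sorted_filter; first by move=> a b c; lia.
      exact: iota_ltn_sorted.
  - move=> z /mapP[x]; rewrite mem_filter mem_iota => /andP[/ltW lx xn] ->.
    by rewrite hil_flip //; lia.
have : (count (fun x => l < `|H x|)%R (iota 0 n) <=
    count (fun x => l < H x)%R (iota 0 n) + count (fun x => l < - H x)%R (iota 0 n))%N.
  rewrite -count_predUI (leq_trans _ (leq_addr _ _)) //.
  by apply: sub_count => x /=; rewrite lter_normr.
rewrite -(ler_nat R) natrD => h; have := ler_wpM2l (ltW l0) h; lra.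
Qed.

End kernel.

(** * Penalized energy *)

Section energy.
Context {R : realType}.
Implicit Types (x y j n : nat) (f g F : nat -> R) (m A : R).

Definition qform n g : R := - \sum_(x < n) \sum_(y < n) g x * g y * kap x y.

(** The boundary value [f n] gives the linear term; the boundary term of [hil_abel] at 0 is absent
    because profiles vanish there. *)
Definition quad n f : R := \sum_(x < n) f x * (f n * cau x.+1 n) + qform n f / 2.

Lemma qform_ge n g :
  \sum_(x < n) \sum_(y < n) kap x y * (g x - g y) ^+ 2 <= 2 * qform n g.
Proof.
have S : \sum_(x < n) \sum_(y < n) g y ^+ 2 * kap x y =
         \sum_(x < n) \sum_(y < n) g x ^+ 2 * kap x y :> R.
  by rewrite exchange_big; apply: eq_bigr => x _; apply: eq_bigr => y _; rewrite kapC.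
have -> : \sum_(x < n) \sum_(y < n) kap x y * (g x - g y) ^+ 2 =
    \sum_(x < n) \sum_(y < n) g x ^+ 2 * kap x y +
    \sum_(x < n) \sum_(y < n) g y ^+ 2 * kap x y -
    2 * \sum_(x < n) \sum_(y < n) g x * g y * kap x y.
  rewrite mulr_sumr -big_split -sumrB; apply: eq_bigr => x _.
  rewrite mulr_sumr -big_split -sumrB; apply: eq_bigr => y _; rewrite /=; ring.
have T : \sum_(x < n) \sum_(y < n) g x ^+ 2 * kap x y <= 0.
  apply: sumr_le0 => x _; rewrite -mulr_sumr sum_kap mulr_ge0_le0 ?sqr_ge0 //.
  by rewrite subr_le0 ltW // (lt_trans (cau_lt0 _)) ?cau_gt0.
by rewrite S /qform; lra.
Qed.

(* The gradient of [quad n] is [hil n]. *)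
Lemma quadD n f g : f 0%N = 0 -> g n = 0 ->
  quad n (fun x => f x + g x) =
  quad n f + \sum_(x < n) g x * hil n f x + qform n g / 2.
Proof.
move=> f0 gn.
have C : \sum_(x < n) \sum_(y < n) f x * g y * kap x y =
         \sum_(x < n) \sum_(y < n) g x * f y * kap x y :> R.
  rewrite exchange_big; apply: eq_bigr => x _; apply: eq_bigr => y _.
  by rewrite kapC; ring.
have -> : \sum_(x < n) g x * hil n f x = \sum_(x < n) g x * (f n * cau x.+1 n)
    - \sum_(x < n) \sum_(y < n) g x * f y * kap x y.
  rewrite -sumrB; apply: eq_bigr => x _; rewrite hil_abel f0 mulrBr mul0r subr0.
  by congr (_ - _); rewrite mulr_sumr; apply: eq_bigr => y _; rewrite mulrA.
rewrite /quad gn addr0.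
have -> : qform n (fun x => f x + g x) = qform n f + qform n g
    - 2 * \sum_(x < n) \sum_(y < n) g x * f y * kap x y.
  have -> : 2 * \sum_(x < n) \sum_(y < n) g x * f y * kap x y =
    \sum_(x < n) \sum_(y < n) g x * f y * kap x y +
    \sum_(x < n) \sum_(y < n) f x * g y * kap x y by rewrite C; ring.
  rewrite /qform -!opprD -!big_split /=; congr (- _).
  apply: eq_bigr => x _; rewrite -!big_split /=; apply: eq_bigr => y _; ring.
have -> : \sum_(x < n) (f x + g x) * (f n * cau x.+1 n) =
   \sum_(x < n) f x * (f n * cau x.+1 n) + \sum_(x < n) g x * (f n * cau x.+1 n).
  by rewrite -big_split; apply: eq_bigr => x _; rewrite mulrDl.
lra.
Qed.

Definition penalized A n F f : R := quad n f + A * \sum_(x < n) `|F x - f x|.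

Definition box n m f : Prop :=
  [/\ f 0%N = 0, f n = m & forall x, (x <= n)%N -> 0 <= f x <= m].

Lemma continuous_sum_ord (T : topologicalType) n (h : 'I_n -> T -> R) :
  (forall i, continuous (h i)) -> continuous (fun t => \sum_(i < n) h i t).
Proof.
move=> hc t; apply: (@cvg_big _ _ +%R 0 xpredT _ _ _ _ h) => [|i _].
  exact: add_continuous.
exact: hc.
Qed.

Lemma quad_continuous (T : topologicalType) n (h : T -> nat -> R) :
  (forall x, continuous (h^~ x)) -> continuous (fun v => quad n (h v)).
Proof.
move=> hc.
have c1 : continuous (fun v => \sum_(x < n) h v x * (h v n * cau x.+1 n)).
  apply: continuous_sum_ord => x v.
  by apply: cvgM; [exact: hc | apply: cvgM; [exact: hc | exact: cvg_cst]].
have c2 : continuous (fun v => \sum_(x < n) \sum_(y < n) h v x * h v y * kap x y).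
  apply: continuous_sum_ord => x; apply: continuous_sum_ord => y v.
  by apply: cvgM; [apply: cvgM; exact: hc | exact: cvg_cst].
move=> v; apply: cvgD; first exact: c1.
by apply: cvgM; [apply: cvgN; exact: c2 | exact: cvg_cst].
Qed.

Lemma penalized_continuous (T : topologicalType) A n F (h : T -> nat -> R) :
  (forall x, continuous (h^~ x)) -> continuous (fun v => penalized A n F (h v)).
Proof.
move=> hc.
have c : continuous (fun v => \sum_(x < n) `|F x - h v x|).
  apply: continuous_sum_ord => x v.
  apply: (@cvg_norm _ _ _ _ _ (fun v => F x - h v x)).
  by apply: cvgB; [exact: cvg_cst | exact: hc].
move=> v; apply: cvgD; first exact: quad_continuous.
by apply: cvgM; [exact: cvg_cst | exact: c].
Qed.

Lemma penalized_min A n F m : (0 < n)%N -> 0 <= m ->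
  exists2 f, box n m f &
    forall g, box n m g -> penalized A n F f <= penalized A n F g.
Proof.
move=> n0 m0.
(* Row vectors provide compactness; position 0 is forced to 0, whatever coordinate 0 of [v] is, and
   positions from [n] on to [m]. *)
pose h (v : 'rV[R]_n) x : R :=
  if x == 0%N then 0 else if insub x is Some i then v ord0 i else m.
have hc x : continuous (h^~ x).
  rewrite /h; case: eqP => _; first exact: cst_continuous.
  by case: insub => [i|]; [exact: coord_continuous | exact: cst_continuous].
pose K := [set v : 'rV[R]_n | forall i, `[0, m]%classic (v ord0 i)].
have Kc : compact K by apply: (@rV_compact _ n (fun=> `[0, m]%classic)) => i; exact: segment_compact.
have K0 : K !=set0.
  by exists (const_mx 0) => i /=; rewrite mxE in_itv /= lexx.
have [v Kv vmin] : exists2 v, v \in K &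
    forall t, t \in K -> penalized A n F (h v) <= penalized A n F (h t).
  apply: EVT_min_rV => //; apply: continuous_subspaceT.
  exact: penalized_continuous.
have hn u : h u n = m by rewrite /h eqn0Ngt n0 /= insubF // ltnn.
exists (h v).
  split => // x xn; rewrite /h; case: eqP => _; first by rewrite lexx.
  case: insubP => [i _ _|_]; last by rewrite lexx m0.
  by move: Kv; rewrite inE => /(_ i) /=; rewrite in_itv.
move=> g [g0 gn gb].
have hg x : (x <= n)%N -> h (\row_i g i) x = g x.
  rewrite /h; case: eqP => [->|_] //; case: insubP => [i _ <-|]; first by rewrite mxE.
  by rewrite -leqNgt => nx xn; rewrite -gn; congr g; lia.
have -> : penalized A n F g = penalized A n F (h (\row_i g i)).
  rewrite /penalized /quad /qform; congr (_ + _ / _ + _ * _).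
  - by apply: eq_bigr => x _; rewrite !hg // ltnW.
  - congr (- _); apply: eq_bigr => x _; apply: eq_bigr => y _.
    by rewrite !hg // ltnW.
  - by apply: eq_bigr => x _; rewrite hg // ltnW.
apply: vmin; rewrite inE => i /=; rewrite mxE in_itv /=; apply: gb; exact: ltnW.
Qed.

(** At a zero of [f] only the positive off-diagonal part of [kap] survives in [hil_abel]. Together
    with [hil_at_top], this makes the constraints of [box] harmless in the first-order
    conditions. *)
Lemma hil_at_bottom n m f x : box n m f -> (0 < x < n)%N -> f x = 0 -> hil n f x <= 0.
Proof.
move=> [f0 fn fb] /andP[x0 xn] fx; rewrite hil_abel f0 mul0r subr0 fn.
have m0 : 0 <= m by have /andP[a b] := fb _ (leqnn n); rewrite fn in a.
rewrite subr_le0 (@le_trans _ _ 0) //; first by rewrite mulr_ge0_le0 // ltW // cau_lt0.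
apply: sumr_ge0 => j _; have [->|xj] := eqVneq (j : nat) x; first by rewrite fx mul0r.
rewrite mulr_ge0 //; first by case/andP: (fb j (ltnW (ltn_ord j))).
by rewrite ltW // kap_gt0 // eq_sym.
Qed.

Lemma hil_at_top n m f x : box n m f -> (0 < x < n)%N -> f x = m -> 0 <= hil n f x.
Proof.
move=> [f0 fn fb] /andP[x0 xn] fx; rewrite hil_abel f0 mul0r subr0 fn.
have m0 : 0 <= m by have /andP[a b] := fb _ (leqnn n); rewrite fn in a.
have -> : m * cau x.+1 n - \sum_(j < n) f j * kap x j =
    m * cau x.+1 0 + \sum_(j < n) (m - f j) * kap x j.
  under [in RHS]eq_bigr do rewrite mulrBl.
  by rewrite sumrB -mulr_sumr sum_kap; ring.
rewrite addr_ge0 //; first by rewrite mulr_ge0 // ltW // cau_gt0.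
apply: sumr_ge0 => j _; have [->|xj] := eqVneq (j : nat) x; first by rewrite fx subrr mul0r.
rewrite mulr_ge0 //; first by rewrite subr_ge0; case/andP: (fb j (ltnW (ltn_ord j))).
by rewrite ltW // kap_gt0 // eq_sym.
Qed.

(** The remainder [2 * s ^+ 2] is the energy of a one-site perturbation, since [kap x x] is - 4. *)
Lemma slope_ge0 (c d : R) : 0 < d ->
  (forall s, 0 < s <= d -> 0 <= s * c + 2 * s ^+ 2) -> 0 <= c.
Proof.
move=> d0 H; rewrite leNgt; apply/negP => c0.
pose s := Num.min d (- c / 4).
have s0 : 0 < s by rewrite lt_min d0 /=; lra.
have sd : s <= d by rewrite ge_min lexx.
have sc : s <= - c / 4 by rewrite ge_min lexx orbT.
have := H s; rewrite s0 sd => /(_ isT); nra.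
Qed.

Lemma penalized_perturb A n m F f x s : box n m f ->
  (forall g, box n m g -> penalized A n F f <= penalized A n F g) ->
  (0 < x < n)%N -> 0 <= f x + s <= m ->
  0 <= s * hil n f x + 2 * s ^+ 2 + A * (`|F x - f x - s| - `|F x - f x|).
Proof.
move=> [f0 fn fb] fmin /andP[x0 xn] fs.
pose g y : R := if y == x then s else 0.
have gn : g n = 0 by rewrite /g ifF //; lia.
have := fmin (fun y => f y + g y).
have bx : box n m (fun y => f y + g y).
  split; [by rewrite f0 /g ifF ?addr0 //; lia|by rewrite gn addr0|].
  by move=> y yn; rewrite /g; case: eqP => [->|_] //; rewrite addr0 fb.
move=> /(_ bx); rewrite /penalized quadD //.
have only (h : nat -> R) : (forall y, y != x -> h y = 0) -> \sum_(y < n) h y = h x.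
  move=> h0; rewrite (bigD1 (Ordinal xn)) //= big1 ?addr0 // => i ix.
  by apply: h0; apply: contraNneq ix => ix; apply/eqP/val_inj.
have gx : g x = s by rewrite /g eqxx.
have g0 y : y != x -> g y = 0 by move=> yx; rewrite /g (negbTE yx).
rewrite (@only (fun y => g y * hil n f y)); last by move=> y /g0 ->; rewrite mul0r.
have -> : qform n g = 4 * s ^+ 2.
  rewrite /qform (@only (fun y => \sum_(z < n) g y * g z * kap y z)).
    rewrite (@only (fun z => g x * g z * kap x z)); first by rewrite gx kapxx; ring.
    by move=> y /g0 ->; rewrite mulr0 mul0r.
  by move=> y /g0 ->; rewrite big1 // => z _; rewrite !mul0r.
have -> : \sum_(y < n) `|F y - (f y + g y)| =
    \sum_(y < n) `|F y - f y| + (`|F x - f x - s| - `|F x - f x|).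
  apply/eqP; rewrite addrC -subr_eq -sumrB.
  rewrite (@only (fun y => `|F y - (f y + g y)| - `|F y - f y|)); last first.
    by move=> y /g0 ->; rewrite addr0 subrr.
  by rewrite gx opprD addrA.
rewrite gx; lra.
Qed.

(** First-order conditions: [hil n f x] lies in [A] times the subdifferential of the absolute value
    at [F x - f x]. Where [f x] is 0 or [m] only one direction is allowed, and [hil_at_bottom] or
    [hil_at_top] supplies the missing inequality. *)
Lemma penalized_opt A n m F f x : 0 < A -> box n m f ->
  (forall g, box n m g -> penalized A n F f <= penalized A n F g) ->
  (0 < x < n)%N -> 0 <= F x <= m ->
  [/\ - A <= hil n f x <= A, f x < F x -> hil n f x = A &
      F x < f x -> hil n f x = - A].
Proof.
move=> A0 fbox fmin xn /andP[F0 Fm].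
have /andP[fx0 fxm] : 0 <= f x <= m by case: fbox => _ _; apply; lia.
(* [up] and [down] move [f x] by at most [d], a range on which the penalty is affine of slope
   [c]. *)
have up d c : 0 < d -> d <= m - f x ->
    (forall s, 0 < s <= d -> `|F x - f x - s| - `|F x - f x| = c * s) ->
    0 <= hil n f x + c * A.
  move=> d0 dm Hs; apply: (slope_ge0 d0) => s /andP[s0 sd].
  have /(penalized_perturb fbox fmin xn) : 0 <= f x + s <= m.
    by apply/andP; split; lra.
  by rewrite Hs ?s0 //; nra.
have down d c : 0 < d -> d <= f x ->
    (forall s, 0 < s <= d -> `|F x - f x + s| - `|F x - f x| = c * s) ->
    0 <= - hil n f x + c * A.
  move=> d0 dm Hs; apply: (slope_ge0 d0) => s /andP[s0 sd].
  have /(penalized_perturb fbox fmin xn) : 0 <= f x - s <= m.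
    by apply/andP; split; lra.
  by rewrite opprK Hs ?s0 //; nra.
have bot := hil_at_bottom fbox xn; have top := hil_at_top fbox xn.
have up1 : f x < F x -> A <= hil n f x.
  move=> lt; have := up (F x - f x) (-1); rewrite subr_gt0 lt => /(_ isT).
  rewrite lerD2r Fm => /(_ isT) h; suff : 0 <= hil n f x + -1 * A by lra.
  by apply: h => s /andP[s0 sd]; rewrite !ger0_norm; lra.
have up2 : F x <= f x -> - A <= hil n f x.
  move=> le; move: fxm; rewrite le_eqVlt => /orP[/eqP/top|lt]; first by lra.
  have := up (m - f x) 1; rewrite subr_gt0 lt lexx => /(_ isT isT) h.
  suff : 0 <= hil n f x + 1 * A by lra.
  by apply: h => s /andP[s0 sd]; rewrite !ler0_norm; lra.
have down1 : F x < f x -> hil n f x <= - A.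
  move=> lt; have := down (f x - F x) (-1); rewrite subr_gt0 lt => /(_ isT).
  rewrite gerBl F0 => /(_ isT) h; suff : 0 <= - hil n f x + -1 * A by lra.
  by apply: h => s /andP[s0 sd]; rewrite !ler0_norm; lra.
have down2 : f x <= F x -> hil n f x <= A.
  move=> le; move: fx0; rewrite le_eqVlt => /orP[/eqP/esym/bot|lt]; first by lra.
  have := down (f x) 1; rewrite lt lexx => /(_ isT isT) h.
  suff : 0 <= - hil n f x + 1 * A by lra.
  by apply: h => s /andP[s0 sd]; rewrite !ger0_norm; lra.
have [lt|lt|eq] := ltgtP (f x) (F x).
- have h1 := up1 lt; have h2 := down2 (ltW lt).
  by split => //; [apply/andP; split; lra | move=> _; lra].
- have h1 := down1 lt; have h2 := up2 (ltW lt).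
  by split => //; [apply/andP; split; lra | move=> _; lra].
- have h1 := up2; have h2 := down2; rewrite eq lexx in h1 h2.
  by split => //; rewrite h1 ?h2.
Qed.

(* A discrete maximum principle: at the most negative increment of [f],
   [hil] strictly decreases, against the signs imposed by [penalized_opt]. *)
Lemma penalized_min_mono A n m F f j : 0 < A -> box n m f ->
  (forall g, box n m g -> penalized A n F f <= penalized A n F g) ->
  (forall x, (x <= n)%N -> 0 <= F x <= m) ->
  (forall x, (x < n)%N -> F x <= F x.+1) ->
  (j < n)%N -> f j <= f j.+1.
Proof.
move=> A0 fbox fmin Fb Fmono jn.
have [f0 fn fb] := fbox.
pose p (i : 'I_n) : R := f i.+1 - f i.
have [x _ xmin] := @arg_minP _ _ 'I_n (Ordinal jn) xpredT p isT.
suff px : 0 <= p x.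
  by rewrite -subr_ge0 (le_trans px) // (xmin (Ordinal jn)).
rewrite leNgt; apply/negP => px.
(* The increment at either end is nonnegative, because [f] takes its extreme values 0 and [m]
   there. *)
have x0 : (0 < x)%N.
  rewrite lt0n; apply/eqP => x0; move: px; rewrite /p x0 f0.
  by have := fb 1%N; rewrite (leq_trans _ jn) // => /(_ isT)/andP[]; lra.
have xn : (x.+1 < n)%N.
  rewrite ltn_neqAle ltn_ord andbT; apply/eqP => xn; move: px; rewrite /p xn fn.
  by have := fb x (ltnW (ltn_ord x)) => /andP[]; lra.
(* Off the diagonal [kap] is positive, so replacing all increments by the least one [p x] lowers the
   sum; what remains is [p x] times a negative row sum. *)
have HH : hil n f x.+1 < hil n f x.
  rewrite -subr_lt0 hil_succ oppr_lt0.
  apply: (@lt_le_trans _ _ (p x * \sum_(i < n) kap x i)).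
    rewrite sum_kap -mulrNN mulr_gt0 ?oppr_gt0 // subr_lt0.
    by rewrite (lt_trans (cau_lt0 _)) ?cau_gt0.
  rewrite mulr_sumr; apply: ler_sum => i _.
  have [<-|xi] := eqVneq (x : nat) i; first by rewrite lexx.
  by apply: ler_wpM2r; [rewrite ltW // kap_gt0 | exact: xmin].
have xn' : (0 < x < n)%N by lia.
have xn'' : (0 < x.+1 < n)%N by lia.
have [/andP[l1 u1] _ o1] := penalized_opt A0 fbox fmin xn' (Fb _ (ltnW (ltn_ord x))).
have [/andP[l2 u2] o2 _] := penalized_opt A0 fbox fmin xn'' (Fb _ (ltn_ord x)).
have := Fmono _ (ltn_ord x); rewrite /p in px.
(* If [f x] exceeds [F x], [hil] is already at its minimum [- A] at [x]. Otherwise [f] is below [F]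
   at [x.+1], where [hil] would be at its maximum [A]. Neither allows a strict decrease. *)
have [le|/o1 lt] := leP (f x) (F x); last by lra.
move=> FF; have /o2 : f x.+1 < F x.+1 by lra.
by lra.
Qed.

End energy.

(** * Gain of the potential under arrivals *)

Section gain.
Context {R : realType}.
Implicit Types (x y j n T t s : nat) (f g F : nat -> R) (m : R).

Lemma sum_window_le n T j (G : nat -> R) : (T <= j)%N -> (j + 1 + T <= n)%N ->
  (forall x, 0 <= G x) ->
  \sum_(t < T) (G (j - t)%N + G (j + 1 + t)%N) <= \sum_(x < n) G x.
Proof.
move=> Tj jn G0; rewrite big_split /= -[leRHS](big_mkord xpredT).
rewrite (@big_cat_nat _ _ _ (j + 1)) /=; [|by []|by lia].
apply: lerD.
  rewrite (@big_cat_nat _ _ _ (j + 1 - T)) /=; [|by []|by lia].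
  rewrite -[leLHS]add0r; apply: lerD; first by rewrite sumr_ge0.
  rewrite -[X in \sum_(X <= _ < _) _]add0n big_addn subKn; last by lia.
  rewrite big_mkord [leLHS](reindex_inj rev_ord_inj) /=.
  rewrite le_eqVlt; apply/orP; left; apply/eqP; apply: eq_bigr => t _.
  by congr G; have := ltn_ord t; lia.
rewrite (@big_cat_nat _ _ _ (j + 1 + T)) /=; [|by lia|by []].
rewrite -[leLHS]addr0; apply: lerD; last by rewrite sumr_ge0.
rewrite -[X in \sum_(X <= _ < _) _]add0n big_addn addKn big_mkord.
rewrite le_eqVlt; apply/orP; left; apply/eqP; apply: eq_bigr => t _.
by congr G; rewrite addnC.
Qed.

Lemma count_inj_le (E : pred nat) (h : nat -> nat) (r : seq nat) n :
  uniq r -> {in r &, injective h} -> (forall j, j \in r -> (h j < n)%N) ->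
  (count (fun j => E (h j)) r <= count E (iota 0 n))%N.
Proof.
move=> ur hi hn; rewrite -(count_map h E) -!size_filter; apply: uniq_leq_size.
  by rewrite filter_uniq // map_inj_in_uniq.
move=> x; rewrite !mem_filter mem_iota => /andP[-> /mapP[j jr ->]].
by rewrite /= hn.
Qed.

Definition harm T : R := \sum_(t < T) t.+1%:R^-1.

Lemma harm_ge_ln T : ln T.+1%:R <= harm T.
Proof.
elim: T => [|T IH]; first by rewrite /harm big_ord0 ln1.
rewrite /harm big_ord_recr /=.
have -> : T.+2%:R = T.+1%:R * (1 + T.+1%:R^-1) :> R.
  by rewrite mulrDr mulr1 divff ?pnatr_eq0 // natr1.
have i0 : 0 < T.+1%:R^-1 :> R by rewrite invr_gt0 ltr0n.
rewrite lnM ?posrE ?ltr0n ?addr_gt0 //; apply: lerD => //.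
by apply: le_ln1Dx; rewrite (lt_trans _ i0) ?ltrN10.
Qed.

(* [dip] tests the logarithmic singularity that an arrival in cell [j] creates
   in the potential: it is a truncated, odd principal value of [1 / x] around
   that cell. *)
Definition dip (c : R) T (V : pred nat) j g : R :=
  \sum_(t < T | V t) c / (t%:R + 2^-1) * (g (j + 1 + t)%N - g (j - t)%N).

(* The increments [g (j + 1 + t) - g (j - t)] are compared with the energy through
   the intermediate points [j + 1 + s], [s <= t]; this gains a factor [T / harm T]
   over the Cauchy-Schwarz inequality on the symmetric pairs alone. *)
Lemma dip_energy c n T (V : pred nat) j g : (T <= j)%N -> (j + 1 + T <= n)%N ->
  2 * dip c T V j g <= qform n g + 16 * c ^+ 2 * harm T.
Proof.
move=> Tj jn; pose w x y := kap x y * (g x - g y) ^+ 2.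
have w0 x y : 0 <= w x y by exact: kap_sqr_ge0.
have wsum : \sum_(t < T) \sum_(s < T) (w (j + 1 + t)%N (j + 1 + s)%N
     + w (j - t)%N (j + 1 + s)%N) <= 2 * qform n g.
  apply: le_trans (qform_ge n g).
  apply: (@le_trans _ _ (\sum_(x < n) \sum_(s < T) w x (j + 1 + s)%N)).
    under eq_bigr do rewrite big_split /= addrC.
    apply: (@sum_window_le n T j (fun x => \sum_(s < T) w x (j + 1 + s)%N)) => // x.
    exact: sumr_ge0.
  apply: ler_sum => x _; apply: le_trans (@sum_window_le _ _ _ (w x) Tj jn (w0 x)).
  by apply: ler_sum => s _; rewrite lerDr.
have pt (t : 'I_T) : 2 * (c / (t%:R + 2^-1) * (g (j + 1 + t)%N - g (j - t)%N)) <=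
    \sum_(s < T) (w (j + 1 + t)%N (j + 1 + s)%N + w (j - t)%N (j + 1 + s)%N) / 2
    + 16 * c ^+ 2 * t.+1%:R^-1.
  (* All distances involved are at most 2t + 1, so [kap] is at least [q ^+ 2]; [r] averages over the
     t + 1 intermediate points. Young's inequality is then applied to both legs of each path. *)
  pose q : R := (2 * t + 1)%:R^-1; pose r : R := t.+1%:R^-1.
  have q0 : 0 < q by rewrite invr_gt0 ltr0n addn1.
  have r0 : 0 < r by rewrite invr_gt0 ltr0n.
  have rt : r * t.+1%:R = 1 by rewrite mulVf // pnatr_eq0.
  have qt : (t%:R + 2^-1)^-1 = 2 * q :> R.
    rewrite /q natrD natrM; have : 0 <= t%:R :> R by [].
    move: (t%:R) => a a0; field; apply: lt0r_neq0; lra.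
  apply: (@le_trans _ _ (\sum_(s < t.+1) ((w (j + 1 + t)%N (j + 1 + s)%N
      + w (j - t)%N (j + 1 + s)%N) / 2 + 16 * c ^+ 2 * r ^+ 2))).
    have -> : 2 * (c / (t%:R + 2^-1) * (g (j + 1 + t)%N - g (j - t)%N)) =
        \sum_(s < t.+1) 4 * c * q * r * (g (j + 1 + t)%N - g (j - t)%N).
      rewrite sumr_const card_ord -[RHS]mulr_natr qt -[LHS]mulr1 -rt; ring.
    apply: ler_sum => s _.
    have st : (s <= t)%N by rewrite -ltnS.
    have qE : q ^+ 2 = ((2 * t + 1)%:R ^+ 2)^-1 by rewrite exprVn.
    have h1 : q ^+ 2 * (g (j + 1 + t)%N - g (j + 1 + s)%N) ^+ 2
        <= w (j + 1 + t)%N (j + 1 + s)%N.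
      rewrite /w; have [->|ts] := eqVneq (s : nat) t.
        by rewrite subrr expr0n /= !mulr0.
      apply: ler_wpM2r; first exact: sqr_ge0.
      by rewrite qE; apply: kap_ge; lia.
    have h2 : q ^+ 2 * (g (j - t)%N - g (j + 1 + s)%N) ^+ 2
        <= w (j - t)%N (j + 1 + s)%N.
      apply: ler_wpM2r; first exact: sqr_ge0.
      by rewrite qE; apply: kap_ge; have := ltn_ord t; lia.
    set a := g (j + 1 + t)%N in h1 *; set b := g (j - t)%N in h2 *.
    set d := g (j + 1 + s)%N in h1 h2.
    have sq1 : 0 <= (q * (a - d) - 4 * c * r) ^+ 2 by exact: sqr_ge0.
    have sq2 : 0 <= (q * (d - b) - 4 * c * r) ^+ 2 by exact: sqr_ge0.
    have e1 : (q * (a - d) - 4 * c * r) ^+ 2 =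
      q ^+ 2 * (a - d) ^+ 2 - 8 * (c * q * r * (a - d)) + 16 * c ^+ 2 * r ^+ 2 by ring.
    have e2 : (q * (d - b) - 4 * c * r) ^+ 2 =
      q ^+ 2 * (b - d) ^+ 2 - 8 * (c * q * r * (d - b)) + 16 * c ^+ 2 * r ^+ 2 by ring.
    have e3 : 4 * c * q * r * (a - b) =
      4 * (c * q * r * (a - d)) + 4 * (c * q * r * (d - b)) by ring.
    rewrite e1 in sq1; rewrite e2 in sq2; rewrite e3; lra.
  rewrite big_split /= sumr_const card_ord -[X in _ + X]mulr_natr; apply: lerD.
    rewrite (big_ord_widen T (fun s => (w (j + 1 + t)%N (j + 1 + s)%N
      + w (j - t)%N (j + 1 + s)%N) / 2)) // big_mkcond.
    by apply: ler_sum => s _; case: ifP => // _; rewrite divr_ge0 // addr_ge0.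
  have -> : 16 * c ^+ 2 * r ^+ 2 * t.+1%:R = 16 * c ^+ 2 * r * (r * t.+1%:R) by ring.
  by rewrite rt mulr1.
rewrite /dip mulr_sumr /harm mulr_sumr.
apply: (@le_trans _ _ (\sum_(t < T) (\sum_(s < T) (w (j + 1 + t)%N (j + 1 + s)%N
      + w (j - t)%N (j + 1 + s)%N) / 2 + 16 * c ^+ 2 * t.+1%:R^-1))).
  rewrite big_mkcond; apply: ler_sum => t _; case: ifP => [_|_]; first exact: pt.
  rewrite addr_ge0 //; first by apply: sumr_ge0 => s _; rewrite divr_ge0 // addr_ge0.
  by rewrite mulr_ge0 ?invr_ge0 // mulr_ge0 // sqr_ge0.
rewrite big_split /= lerD2r.
under eq_bigr do rewrite -mulr_suml.
by rewrite -mulr_suml; lra.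
Qed.


Definition step j x : R := (j < x)%N%:R.

(* Distances [t] at which [dip] may perturb the gradient [hil n f] on both sides of
   cell [j] without leaving the interval [- 64, 64]. *)
Definition cool n f T j : pred nat := fun t =>
  [&& (T <= j)%N, (j + 1 + T <= n)%N, `|hil n f (j - t)%N| <= 32 &
      `|hil n f (j + 1 + t)%N| <= 32].

(** The increments form a positive measure of mass [n], so [boole_count] at level 32 leaves at most
    n/8 bad points. *)
Lemma hot_count n f : box n n%:R f -> (forall j, (j < n)%N -> f j <= f j.+1) ->
  (8 * count (fun x => 32 < `|hil n f x|)%R (iota 0 n) <= n)%N.
Proof.
move=> [f0 fn _] fmono.
have S : \sum_(j < n) (f j.+1 - f j) = n%:R.
  by rewrite -(big_mkord xpredT (fun j => f j.+1 - f j)) telescope_sumr // f0 fn subr0.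
have H : 32 * (count (fun x => 32 < `|hil n f x|) (iota 0 n))%:R <= 4 * n%:R :> R.
  rewrite -S; apply: (@boole_count R n (fun j => f j.+1 - f j) 32) => [|j jn].
    by lra.
  by rewrite subr_ge0 fmono.
move: H; rewrite -!natrM ler_nat; lia.
Qed.

(** The weights of [dip] are at most 1/16 in absolute value and sit where [hil] is at most 32, so
    [hil] plus these weights stays in [- 64, 64]: it is still a dual vector for the penalty.
    Position 0 is removed by [u 0 = 0]. *)
Lemma dip_bound n f T j (u : nat -> R) :
  (forall x, (0 < x < n)%N -> `|hil n f x| <= 64) -> u 0%N = 0 ->
  \sum_(x < n) hil n f x * u x + dip 32^-1 T (cool n f T j) j u
    <= 64 * \sum_(x < n) `|u x|.
Proof.
move=> hb u0.
pose G x : R := if `|hil n f x| <= 32 then 32 * `|u x| else 0.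
have G0 x : 0 <= G x by rewrite /G; case: ifP => // _; rewrite mulr_ge0.
have dG : dip 32^-1 T (cool n f T j) j u <= \sum_(x < n) G x.
  rewrite /dip /cool; have [Tj|Tj] := leqP T j; last first.
    by rewrite big_pred0 // sumr_ge0.
  have [jn|jn] := leqP (j + 1 + T) n; last by rewrite big_pred0 // sumr_ge0.
  apply: le_trans (sum_window_le Tj jn G0).
  rewrite big_mkcond; apply: ler_sum => t _.
  case: ifP => [/and4P[_ _ h1 h2]|_]; last by rewrite addr_ge0.
  rewrite /G h1 h2.
  have c1 : 0 <= 32^-1 / (t%:R + 2^-1 : R) <= 1.
    have t0 : 0 <= t%:R :> R by [].
    by apply/andP; split; [rewrite divr_ge0 //; lra | rewrite ler_pdivrMr; lra].
  have := ler_norm (u (j + 1 + t)%N); have := ler_norm (- u (j - t)%N).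
  rewrite normrN; have := normr_ge0 (u (j + 1 + t)%N); have := normr_ge0 (u (j - t)%N).
  by case/andP: c1; nra.
rewrite mulr_sumr; apply: le_trans (lerD (lexx _) dG) _.
rewrite -big_split /=; apply: ler_sum => x _.
have [x0|x0] := posnP x.
  by rewrite x0 /G u0 normr0 !mulr0 if_same addr0.
have le1 : hil n f x * u x <= `|hil n f x| * `|u x| by rewrite -normrM ler_norm.
have := hb x; rewrite x0 ltn_ord => /(_ isT) le2.
have u1 := normr_ge0 (u x).
by rewrite /G; case: ifP => h; nra.
Qed.

Lemma dip_out n f T j (c : R) u : ~~ ((T <= j)%N && (j + 1 + T <= n)%N) ->
  dip c T (cool n f T j) j u = 0.
Proof.
by move=> out; rewrite /dip big_pred0 // => t; rewrite /cool andbA (negbTE out).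
Qed.

Lemma dip_comb c T (V : pred nat) j (u1 u2 u3 u4 : nat -> R) :
  dip c T V j (fun x => u1 x + u2 x - u3 x - u4 x) =
  dip c T V j u1 + dip c T V j u2 - dip c T V j u3 - dip c T V j u4.
Proof.
rewrite /dip -big_split -!sumrB; apply: eq_bigr => t _ /=; ring.
Qed.

(** Convex duality: expand [quad] exactly at [f] and bound the penalty at [g] from below by the dual
    vector of [dip_bound]. The terms linear in [z] cancel, except for [dip] of [z], which half of
    [qform n z] absorbs at the price [harm T / 128]. *)
Lemma gain_one n T i j F f g : (0 < n)%N -> box n n%:R f -> box n n%:R F ->
  (forall g, box n n%:R g -> penalized 64 n F f <= penalized 64 n F g) ->
  box n n%:R g ->
  penalized 64 n F f + \sum_(x < n) hil n f x * (step j x - step i x)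
    + dip 32^-1 T (cool n f T j) j (step j)
    - dip 32^-1 T (cool n f T j) j (step i) - harm T / 128
  <= penalized 64 n (fun x => F x + step j x - step i x) g.
Proof.
move=> n0 fbox Fbox fmin gbox.
have [f0 fn _] := fbox; have [F0 Fn Fb] := Fbox; have [g0 gn _] := gbox.
have opt x : (0 < x < n)%N ->
    [/\ - 64 <= hil n f x <= 64, f x < F x -> hil n f x = 64 &
      F x < f x -> hil n f x = - 64].
  by move=> xn; apply: (penalized_opt _ fbox fmin) => //; apply: Fb; lia.
pose z x := g x - f x.
pose V := cool n f T j.
pose u x := (F x - f x) + step j x - step i x - z x.
have uE x : u x = F x + step j x - step i x - g x by rewrite /u /z; ring.
have u0 : u 0%N = 0 by rewrite /u /z /step F0 f0 g0 !ltn0 !subrr addr0 !subr0.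
have D1 : \sum_(x < n) hil n f x * u x + dip 32^-1 T V j u
    <= 64 * \sum_(x < n) `|u x|.
  by apply: dip_bound => // x /opt[]; rewrite ler_norml.
have S1 : \sum_(x < n) hil n f x * u x = 64 * \sum_(x < n) `|F x - f x|
    + \sum_(x < n) hil n f x * (step j x - step i x) - \sum_(x < n) z x * hil n f x.
  rewrite mulr_sumr -big_split -sumrB /=; apply: eq_bigr => x _.
  have <- : hil n f x * (F x - f x) = 64 * `|F x - f x|.
    have [x0|x0] := posnP x; first by rewrite x0 F0 f0 subrr normr0 !mulr0.
    have := opt x; rewrite x0 ltn_ord => /(_ isT)[_ o1 o2].
    have [lt|lt|->] := ltgtP (f x) (F x); last by rewrite subrr normr0 !mulr0.
      by rewrite o1 // ger0_norm // subr_ge0 ltW.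
    by rewrite o2 // ler0_norm ?subr_le0 ?ltW //; ring.
  by rewrite /u; ring.
have D2 : dip 32^-1 T V j u = dip 32^-1 T V j (step j) - dip 32^-1 T V j (step i)
    - dip 32^-1 T V j z.
  rewrite /u (dip_comb _ _ _ _ (fun x => F x - f x)).
  suff -> : dip 32^-1 T V j (fun x => F x - f x) = 0 by rewrite add0r.
  rewrite /dip big1 // => t /and4P[Tj jn h1 h2].
  have tT := ltn_ord t.
  (* Where [hil] is strictly inside [- 64, 64], the first-order conditions force [f] to agree with
     [F]. *)
  have zero x : (0 < x < n)%N -> `|hil n f x| <= 32 -> F x - f x = 0.
    move=> /opt[_ o1 o2]; rewrite ler_norml => /andP[l1 l2].
    have [lt|lt|->] := ltgtP (f x) (F x); last by rewrite subrr.
      by have := o1 lt; lra.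
    by have := o2 lt; lra.
  by rewrite !zero ?subrr ?mulr0 //; lia.
have D3 : dip 32^-1 T V j z <= qform n z / 2 + harm T / 128.
  have [/andP[Tj jn]|out] := boolP ((T <= j)%N && (j + 1 + T <= n)%N).
    by have := @dip_energy 32^-1 n T V j z Tj jn; lra.
  rewrite (dip_out _ _ _ out).
  have q0 : 0 <= 2 * qform n z.
    apply: le_trans (qform_ge _ _); apply: sumr_ge0 => x _; apply: sumr_ge0 => y _.
    exact: kap_sqr_ge0.
  have h0 : 0 <= harm T by apply: sumr_ge0 => t _; rewrite invr_ge0.
  by lra.
have Q : quad n g = quad n f + \sum_(x < n) z x * hil n f x + qform n z / 2.
  rewrite -quadD //; last by rewrite /z gn fn subrr.
  by congr (quad n _); apply/funext => x; rewrite /z; ring.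
rewrite {2}/penalized Q {1}/penalized.
have -> : \sum_(x < n) `|F x + step j x - step i x - g x| = \sum_(x < n) `|u x|.
  by apply: eq_bigr => x _; rewrite uE.
rewrite -/V; lra.
Qed.

(** Of the [n] cells, at most 2T, hence n/4, are too close to an end, and each of the two shifts
    meets at most n/8 bad points. *)
Lemma cool_count n T f t : box n n%:R f -> (forall j, (j < n)%N -> f j <= f j.+1) ->
  (8 * T <= n)%N -> (t < T)%N ->
  (n <= 2 * count (fun j => cool n f T j t) (iota 0 n))%N.
Proof.
move=> fbox fmono Tn tT; have hot := hot_count fbox fmono.
pose E x := 32 < `|hil n f x|.
pose r := iota T (n - 2 * T).
have c1 : (count (fun j => E (j - t)%N) r <= count E (iota 0 n))%N.
  apply: (@count_inj_le E (fun j => j - t)%N); first exact: iota_uniq.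
  - by move=> a b; rewrite !mem_iota => *; lia.
  - by move=> a; rewrite mem_iota; lia.
have c2 : (count (fun j => E (j + 1 + t)%N) r <= count E (iota 0 n))%N.
  apply: (@count_inj_le E (fun j => j + 1 + t)%N); first exact: iota_uniq.
  - by move=> a b _ _; lia.
  - by move=> a; rewrite mem_iota; lia.
have c3 : (count (fun j => cool n f T j t) r <= count (fun j => cool n f T j t) (iota 0 n))%N.
  rewrite -[X in (_ <= count X _)%N]/(fun j => cool n f T (id j) t).
  apply: (@count_inj_le (fun j => cool n f T j t) id); first exact: iota_uniq.
  - by [].
  - by move=> a; rewrite mem_iota; lia.
have c4 : (size r <= count (fun j => cool n f T j t) r +
    (count (fun j => E (j - t)%N) r + count (fun j => E (j + 1 + t)%N) r))%N.
  rewrite -(count_predC (fun j => cool n f T j t) r) leq_add2l.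
  rewrite -count_predUI (leq_trans _ (leq_addr _ _)) //.
  rewrite -(@eq_in_count _ (fun j => E (j - t)%N || E (j + 1 + t)%N)) ?leqnn //.
  move=> j; rewrite mem_iota => jr /=; rewrite /cool /E.
  have -> : (T <= j)%N by lia.
  have -> : (j + 1 + T <= n)%N by lia.
  by rewrite /= negb_and -!ltNge.
have sr : size r = (n - 2 * T)%N by rewrite size_iota.
rewrite -[count E _]/(count (fun x => 32 < `|hil n f x|) (iota 0 n)) in c1 c2.
lia.
Qed.

Lemma sum_step n x : (x <= n)%N -> \sum_(i < n) step i x = x%:R.
Proof.
move=> xn; rewrite /step -natr_sum; congr (_%:R).
rewrite -[LHS](big_mkord xpredT (fun i => nat_of_bool (i < x)%N)).
rewrite (@big_cat_nat _ _ _ x) //= big_nat.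
under eq_bigr => i /andP[_ ix] do rewrite ix.
rewrite -big_nat sum_nat_const_nat subn0 muln1 big_nat big1 ?addn0 // => i /andP[xi _].
by rewrite ltnNge xi.
Qed.

(** Sum [gain_one] over all pairs of cells. Per pair, the arrival's own [dip] gives on average at
    least [harm T / 64]; the energy takes back [harm T / 128] and the demand's [dip] at most
    1/128. *)
Lemma potential n T : (0 < n)%N -> (8 * T <= n)%N ->
  exists Phi : (nat -> R) -> R,
    (forall F G, Phi F <= Phi G + 64 * \sum_(x < n) `|F x - G x|) /\
    (forall F, box n n%:R F -> (forall x, (x < n)%N -> F x <= F x.+1) ->
      n%:R ^+ 2 * (Phi F + (harm T - 1) / 128) <=
      \sum_(i < n) \sum_(j < n) Phi (fun x => F x + step j x - step i x)).
Proof.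
move=> n0 Tn.
have /choice[a aP] : forall F : nat -> R, exists f, box n n%:R f /\
    forall g, box n n%:R g -> penalized 64 n F f <= penalized 64 n F g.
  move=> F; have [f fb fm] := @penalized_min R 64 n F n%:R n0 ltac:(by []).
  by exists f.
exists (fun F => penalized 64 n F (a F)); split => [F G|F Fbox Fmono].
  have [_ aF] := aP F; have [aG _] := aP G.
  apply: le_trans (aF _ aG) _; rewrite /penalized.
  suff : \sum_(x < n) `|F x - a G x| <=
      \sum_(x < n) `|F x - G x| + \sum_(x < n) `|G x - a G x| by lra.
  rewrite -big_split /=; apply: ler_sum => x _; exact: ler_distD.
have [fbox fmin] := aP F; set f := a F in fbox fmin *.
have Fb : forall x, (x <= n)%N -> 0 <= F x <= n%:R by case: Fbox.
have fmono j : (j < n)%N -> f j <= f j.+1.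
  by apply: (penalized_min_mono _ fbox fmin).
have nn : n%:R = \sum_(i < n) (1 : R) by rewrite sumr_const card_ord.
pose V := cool n f T.
pose K := \sum_(j < n) dip 32^-1 T (V j) j (step j).
pose L := \sum_(i < n) \sum_(j < n) dip 32^-1 T (V j) j (step i).
pose Z := \sum_(i < n) \sum_(j < n) \sum_(x < n)
  hil n f x * (step j x - step i x).
(* The linear term is antisymmetric in the two cells. *)
have Z0 : Z = 0.
  suff : Z = - Z by lra.
  rewrite {1}/Z exchange_big -sumrN; apply: eq_bigr => i _; rewrite -sumrN.
  apply: eq_bigr => j _; rewrite -sumrN; apply: eq_bigr => x _; ring.
have low : n%:R ^+ 2 * penalized 64 n F f + Z + n%:R * K - L
     - n%:R ^+ 2 * (harm T / 128) <=
    \sum_(i < n) \sum_(j < n) penalized 64 n (fun x => F x + step j x - step i x)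
       (a (fun x => F x + step j x - step i x)).
  have E (c : R) : n%:R ^+ 2 * c = \sum_(i < n) \sum_(j < n) c.
    by rewrite !sumr_const !card_ord -[RHS]mulr_natr -[c *+ n]mulr_natr; ring.
  have EK : n%:R * K = \sum_(i < n) K by rewrite sumr_const card_ord -[RHS]mulr_natr mulrC.
  rewrite !E EK /Z /L /K -!big_split -!sumrB /=; apply: ler_sum => i _.
  rewrite -!big_split -!sumrB /=; apply: ler_sum => j _.
  by apply: gain_one => //; case: (aP (fun x => F x + step j x - step i x)).
have KE : n%:R / 64 * harm T <= K.
  have -> : K = \sum_(j < n) \sum_(t < T) (V j t)%:R * (32^-1 / (t%:R + 2^-1)).
    apply: eq_bigr => j _; rewrite /dip big_mkcond; apply: eq_bigr => t _.
    case: ifP => [/and4P[Tj jn _ _]|_]; last by rewrite mul0r.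
    rewrite mul1r /step; have -> : (j < j + 1 + t)%N by lia.
    have -> : (j < j - t)%N = false by lia.
    by rewrite subr0 mulr1.
  rewrite exchange_big /= /harm mulr_sumr; apply: ler_sum => t _.
  rewrite -mulr_suml -natr_sum.
  have : n%:R <= 2 * (\sum_(j < n) V j t)%:R :> R.
    rewrite -natrM ler_nat.
    have -> : (\sum_(j < n) V j t = count (fun j => V j t) (iota 0 n))%N.
      rewrite -sum1_count [RHS]big_mkcond -[LHS](big_mkord xpredT (fun j => nat_of_bool (V j t))).
      by rewrite /index_iota subn0; apply: eq_bigr => j _; case: (V j t).
    exact: cool_count.
  set v : R := (\sum_(j < n) _)%:R => nv.
  have t0 : 0 <= t%:R :> R by [].
  have i1 : t.+1%:R^-1 <= (t%:R + 2^-1)^-1 :> R.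
    by rewrite -(natr1 t) lef_pV2 ?posrE; lra.
  have i0 : 0 <= t.+1%:R^-1 :> R by rewrite invr_ge0.
  have n1 : 0 <= n%:R :> R by [].
  move: i0 i1; rewrite -[32^-1 / _]/(32^-1 * (t%:R + 2^-1)^-1).
  move: (t.+1%:R^-1) ((_ + _)^-1) => r q r0 rq.
  have h1 : 0 <= (2 * v - n%:R) * r by rewrite mulr_ge0 //; lra.
  have h2 : 0 <= v * (q - r) by rewrite mulr_ge0 //; lra.
  by rewrite [v * _]mulrCA; lra.
(* Summed over [i], the step at [i] turns each difference in [dip] into 2t + 1, which cancels the
   weight: every [t] contributes at most 1/16, and [T] is at most n/8. *)
have LE : L <= n%:R ^+ 2 / 128.
  rewrite /L exchange_big /=.
  have -> : n%:R ^+ 2 / 128 = \sum_(j < n) (n%:R / 128 : R).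
    by rewrite sumr_const card_ord -[RHS]mulr_natr; ring.
  apply: ler_sum => j _.
  rewrite /dip exchange_big /=.
  apply: (@le_trans _ _ (\sum_(t < T) 16^-1)).
    rewrite [leLHS]big_mkcond; apply: ler_sum => t _; case: ifP => // /and4P[Tj jn _ _].
    rewrite -mulr_sumr sumrB !sum_step; [|by lia|by have := ltn_ord t; lia].
    have t0 : 0 <= t%:R :> R by [].
    rewrite natrB; last by have := ltn_ord t; lia.
    rewrite !natrD; set J : R := j%:R; rewrite le_eqVlt; apply/orP; left; apply/eqP.
    have -> : J + 1 + t%:R - (J - t%:R) = 2 * (t%:R + 2^-1) by field.
    by field; apply: lt0r_neq0; lra.
  rewrite sumr_const card_ord -[leLHS]mulr_natr.
  have : (8 * T)%:R <= n%:R :> R by rewrite ler_nat.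
  by rewrite natrM; lra.
apply: le_trans low; rewrite Z0.
have n1 : 0 <= n%:R :> R by [].
have := ler_wpM2l n1 KE; nra.
Qed.

End gain.

(** * Cells and measurability *)

Section cells.
Context {R : realType}.
Implicit Types (x y : R) (n k : nat).

(** The cap puts the right endpoint 1 into the last cell. *)
Definition cell n x : 'I_n.+1 := inord (minn n (Num.truncn (n.+1%:R * x))).

Lemma cell_gt n x k :
  (k < cell n x)%N = (k < n)%N && (k.+1%:R <= n.+1%:R * x).
Proof. by rewrite inordK ?ltnS ?geq_minl // leq_min truncn_gt_nat. Qed.

Lemma cell_dist n x y :
  `|(cell n x)%:R - (cell n y)%:R| <= n.+1%:R * `|x - y| + 1 :> R.
Proof.
wlog lt : x y / (cell n x < cell n y)%N.
  move=> H; have [lt|lt|->] := ltngtP (cell n x) (cell n y); first exact: H.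
    by rewrite distrC [`|x - y|]distrC; exact: H.
  by rewrite subrr normr0 addr_ge0 // mulr_ge0.
set i := cell n x in lt *; set j := cell n y in lt *.
have i0 : (i < n)%N by have := ltn_ord j; lia.
have ix : n.+1%:R * x < i%:R + 1.
  have := cell_gt n x i; rewrite ltnn i0 /= -(natr1 i) => /esym/negbT.
  by rewrite -ltNge.
have jy : j%:R <= n.+1%:R * y.
  have := cell_gt n y j.-1; rewrite prednK ?(leq_ltn_trans _ lt) //.
  by rewrite leqnn => /esym/andP[].
have ij : i%:R <= j%:R :> R by rewrite ler_nat ltnW.
rewrite ler0_norm ?subr_le0 //.
have : n.+1%:R * (y - x) <= n.+1%:R * `|x - y|.
  by rewrite ler_wpM2l // distrC ler_norm.
by rewrite mulrBr; lra.
Qed.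

(** Unlike single cells, these are half-lines (or trivial), and a cell is the difference of two of
    them. *)
Definition upper_cells n k := [set x | (k <= cell n x)%N].

Lemma upper_cellsS n k : upper_cells n k.+1 =
  if (k < n)%N then `[k.+1%:R / n.+1%:R, +oo[%classic else set0.
Proof.
apply/seteqP; split => x; rewrite /upper_cells /= cell_gt; case: ifP => //= kn.
  by rewrite in_itv /= andbT ler_pdivrMr ?ltr0n // mulrC.
by rewrite in_itv /= andbT ler_pdivrMr ?ltr0n // mulrC.
Qed.

Lemma measurable_upper_cells n k : measurable (upper_cells n k).
Proof.
case: k => [|k]; last by rewrite upper_cellsS; case: ifP.
rewrite (_ : upper_cells n 0 = setT) //; exact/seteqP.
Qed.

Lemma cell_fiber n (i : 'I_n.+1) :
  [set x | cell n x = i] = upper_cells n i `\` upper_cells n i.+1.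
Proof.
apply/seteqP; split => x; rewrite /upper_cells /=; first by move=> ->; rewrite leqnn ltnn.
case=> le /negP; rewrite -leqNgt => ge; apply/val_inj/eqP.
by rewrite eqn_leq; apply/andP.
Qed.

Lemma measurable_cell n (i : 'I_n.+1) : measurable [set x | cell n x = i].
Proof. by rewrite cell_fiber; apply: measurableD; exact: measurable_upper_cells. Qed.

Lemma uniform_upper_cells n k : (k <= n.+1)%N ->
  uniform_prob (@ltr01 R) (upper_cells n k) = (1 - k%:R / n.+1%:R)%:E.
Proof.
move=> kn; rewrite /uniform_prob integral_uniform_pdf.
have n0 : 0 < n.+1%:R :> R by rewrite ltr0n.
have q0 : 0 <= k%:R / n.+1%:R :> R by rewrite divr_ge0.
move: kn; rewrite leq_eqVlt => /orP[/eqP ->|kn].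
  rewrite upper_cellsS ltnn set0I integral_set0 divff ?subrr //; exact: lt0r_neq0.
have q1 : k%:R / n.+1%:R < 1 :> R by rewrite ltr_pdivrMr // mul1r ltr_nat.
have -> : upper_cells n k `&` `[0, 1] = `[k%:R / n.+1%:R, 1]%classic.
  apply/seteqP; split => x /=; rewrite !in_itv /=.
    case=> + /andP[x0 ->]; rewrite andbT; case: k kn q0 q1 => [|k] kn q0 q1 h.
      by rewrite mul0r.
    by move: h; rewrite upper_cellsS (ltnSE kn) /= in_itv /= andbT.
  move=> /andP[kx x1]; rewrite x1 (le_trans q0 kx); split => //.
  case: k kn q0 q1 kx => [|k] kn q0 q1 kx //.
  by rewrite upper_cellsS (ltnSE kn) /= in_itv /= andbT.
rewrite (eq_integral (fun=> 1%:E)); last first.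
  move=> x; rewrite inE /= in_itv /= /uniform_pdf => /andP[kx x1].
  by rewrite x1 (le_trans q0 kx) /= subr0 invr1.
by rewrite integral_cst //= mul1e lebesgue_measure_itv /= lte_fin q1.
Qed.

Lemma uniform_cell n (i : 'I_n.+1) :
  uniform_prob (@ltr01 R) [set x | cell n x = i] = (n.+1%:R^-1)%:E.
Proof.
rewrite cell_fiber measureD; last 3 first.
- exact: measurable_upper_cells.
- exact: measurable_upper_cells.
- by rewrite /= uniform_upper_cells ?ltry // ltnW.
rewrite setIidr; last by move=> x; rewrite /upper_cells /=; exact: ltnW.
rewrite /= !uniform_upper_cells // 1?ltnW // -EFinB; congr EFin.
by rewrite -(natr1 i); ring.
Qed.

End cells.

(* A map into a finite type is treated as measurable when its fibers are. *)
Section finite_valued.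
Context d (Omega : measurableType d).
Implicit Types (T : finType).

Definition finite_valued T (g : Omega -> T) := forall y, measurable [set w | g w = y].

Lemma finite_valued_pred T (g : Omega -> T) (Q : pred T) : finite_valued g ->
  measurable [set w | Q (g w)].
Proof.
move=> mg; rewrite (_ : [set w | Q (g w)] = \bigcup_(y in [set y | Q y]) [set w | g w = y]).
  by apply: fin_bigcup_measurable => //; exact: finite_finset.
by apply/seteqP; split => [w Qw|w [y Qy /= ->]] //; exists (g w).
Qed.

Lemma finite_valued_pair T1 T2 (g : Omega -> T1) (h : Omega -> T2) :
  finite_valued g -> finite_valued h -> finite_valued (fun w => (g w, h w)).
Proof.
move=> mg mh [y z]; rewrite (_ : [set w | _] = [set w | g w = y] `&` [set w | h w = z]).
  exact: measurableI.
by apply/seteqP; split => w /= => [[-> ->]|[-> ->]].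
Qed.

Lemma finite_valued_comp T1 T2 (g : Omega -> T1) (h : T1 -> T2) :
  finite_valued g -> finite_valued (h \o g).
Proof.
move=> mg y; rewrite (_ : [set w | _] = [set w | [pred z | h z == y] (g w)]).
  exact: finite_valued_pred.
by apply/seteqP; split => w /= /eqP.
Qed.

Lemma finite_valued_ffun (I T : finType) (g : Omega -> {ffun I -> T}) :
  (forall i, finite_valued (fun w => g w i)) -> finite_valued g.
Proof.
move=> mg y; rewrite (_ : [set w | _] = \bigcap_(i in [set: I]) [set w | g w i = y i]).
  by apply: fin_bigcap_measurable => [|i _]; [exact: finite_finset|exact: mg].
apply/seteqP; split => [w /= <-|w H] //=; apply/ffunP => i; exact: H.
Qed.

(** Policies are measurable for each fixed history; as histories form a finite type, a random
    history may be substituted. *)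
Lemma finite_valued_kernel T T' (g : Omega -> T) (h : T -> Omega -> T') :
  finite_valued g -> (forall y, finite_valued (h y)) ->
  finite_valued (fun w => h (g w) w).
Proof.
move=> mg mh z; rewrite (_ : [set w | _] =
    \bigcup_(y in [set: T]) ([set w | g w = y] `&` [set w | h y w = z])).
  apply: fin_bigcup_measurable => [|y _]; first exact: finite_finset.
  by apply: measurableI; [exact: mg|exact: mh].
by apply/seteqP; split => [w /= E|w [y _ /= [-> ->]]] //; exists (g w).
Qed.

Lemma integral_finite_valued (R : realType) (P : probability Omega R) T
    (X : Omega -> T) (h : T -> R) : finite_valued X -> (forall y, 0 <= h y) ->
  (\int[P]_w (h (X w))%:E = \sum_y (h y)%:E * P [set w | X w = y])%E.
Proof.
move=> mX h0.
transitivity (\int[P]_w (\sum_y (h y)%:E * (\1_[set w | X w = y] w)%:E))%E.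
  apply: eq_integral => w _; rewrite (bigD1 (X w)) //= big1 ?adde0.
    by rewrite indicE mem_set // mule1.
  by move=> y yX; rewrite indicE memNset ?mule0 //= => E; rewrite E eqxx in yX.
rewrite ge0_integral_sum //; last first.
- by move=> y w _; rewrite mule_ge0 // lee_fin.
- by move=> y; apply: measurable_funeM; apply/measurable_EFinP; exact: measurable_indic.
apply: eq_bigr => y _; rewrite ge0_integralZl_EFin //; last first.
- by apply/measurable_EFinP; exact: measurable_indic.
- by rewrite integral_indic // setIT.
Qed.

End finite_valued.

(** * Measurability of the trajectories *)

Section measurable_dynamics.
Context (dU : measure_display) (U : measurableType dU) (R : realType) (m : nat).
Variables (pi : policy U R m) (x0 : 'I_m -> R).
Context d (Omega : measurableType d).
Variables (W : Omega -> U) (D S : nat -> Omega -> R).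
Hypothesis mW : measurable_fun setT W.

Lemma finite_valued_decide t h : (forall s, (s <= t)%N -> measurable_fun setT (D s)) ->
  (forall s, (s < t)%N -> measurable_fun setT (S s)) ->
  finite_valued (fun w => decide pi (W w) x0 (D ^~ w) (S ^~ w) (t := t) h).
Proof.
move=> mD mS i.
pose f w := (W w, ([tuple D s w | s < t.+1], [tuple S s w | s < t])).
have mf : measurable_fun setT f.
  apply: measurable_fun_pair => //; apply: measurable_fun_pair.
    apply/measurable_fun_tnthP => s.
    rewrite (_ : _ \o _ = D s); first by apply: mD; rewrite -ltnS.
    by apply/funext => w /=; rewrite tnth_mktuple.
  apply/measurable_fun_tnthP => s.
  rewrite (_ : _ \o _ = S s); first exact: mS.
  by apply/funext => w /=; rewrite tnth_mktuple.
have := mf measurableT _ (measurable_match_choice pi x0 h i).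
by rewrite setTI.
Qed.

Lemma finite_valued_past t : (forall s, (s < t)%N -> measurable_fun setT (D s)) ->
  (forall s, (s < t)%N -> measurable_fun setT (S s)) ->
  finite_valued (fun w => past_decisions pi (W w) x0 (D ^~ w) (S ^~ w) t).
Proof.
elim: t => [|t IH] mD mS /=.
  move=> y; rewrite (_ : [set w | _] = setT) //.
  by apply/seteqP; split => // w _ /=; rewrite [y]tuple0.
apply: (@finite_valued_kernel _ _ _ _
   (fun w => past_decisions pi (W w) x0 (D ^~ w) (S ^~ w) t)
   (fun h w => [tuple of rcons h (decide pi (W w) x0 (D ^~ w) (S ^~ w) h)])).
  by apply: IH => s st; [apply: mD|apply: mS]; exact: ltnW.
move=> h; apply: (@finite_valued_comp _ _ _ _
   (fun w => decide pi (W w) x0 (D ^~ w) (S ^~ w) h) (fun i => [tuple of rcons h i])).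
by apply: finite_valued_decide => s st; [apply: mD|apply: mS => //; exact: ltnW].
Qed.

Lemma finite_valued_decision t : (forall s, (s <= t)%N -> measurable_fun setT (D s)) ->
  (forall s, (s < t)%N -> measurable_fun setT (S s)) ->
  finite_valued (fun w => decision pi (W w) x0 (D ^~ w) (S ^~ w) t).
Proof.
move=> mD mS; apply: (@finite_valued_kernel _ _ _ _
   (fun w => past_decisions pi (W w) x0 (D ^~ w) (S ^~ w) t)
   (fun h w => decide pi (W w) x0 (D ^~ w) (S ^~ w) h)).
  by apply: finite_valued_past => // s st; apply: mD; exact: ltnW.
by move=> h; exact: finite_valued_decide.
Qed.

Lemma measurable_supply t i : (forall s, (s < t)%N -> measurable_fun setT (D s)) ->
  (forall s, (s < t)%N -> measurable_fun setT (S s)) ->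
  measurable_fun setT (fun w => supply_locations pi (W w) x0 (D ^~ w) (S ^~ w) t i).
Proof.
elim: t => [|t IH] mD mS /=; first exact: measurable_cst.
apply: measurable_fun_ifT; [|exact: mS|]; last first.
  by apply: IH => s st; [apply: mD|apply: mS]; exact: ltnW.
apply: (measurable_fun_bool true).
rewrite setTI (_ : _ @^-1` _ = [set w | [pred k | i == k]
   (decision pi (W w) x0 (D ^~ w) (S ^~ w) t)]) //.
apply: finite_valued_pred; apply: finite_valued_decision => s st.
  exact: mD.
by apply: mS; exact: ltnW.
Qed.

Lemma finite_valued_cells n t : (forall s, (s < t)%N -> measurable_fun setT (D s)) ->
  (forall s, (s < t)%N -> measurable_fun setT (S s)) ->
  finite_valued (fun w => [ffun i =>
    cell n (supply_locations pi (W w) x0 (D ^~ w) (S ^~ w) t i)]).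
Proof.
move=> mD mS; apply: finite_valued_ffun => i y.
rewrite (_ : [set w | _] = (fun w => supply_locations pi (W w) x0 (D ^~ w) (S ^~ w) t i)
  @^-1` [set x | cell n x = y]).
  rewrite -[X in measurable X]setTI; apply: measurable_supply => //.
  exact: measurable_cell.
by apply/seteqP; split => w /=; rewrite ffunE.
Qed.

Lemma measurable_average_cost N : (forall s, measurable_fun setT (D s)) ->
  (forall s, measurable_fun setT (S s)) ->
  measurable_fun setT (fun w => average_cost pi (W w) x0 (D ^~ w) (S ^~ w) N).
Proof.
move=> mD mS; apply: measurable_funM; last exact: measurable_cst.
apply: measurable_sum => t.
apply: (measurableT_comp (@normr_measurable R setT)); apply: measurable_funB; first exact: mD.
rewrite (_ : (fun w => _) = fun w => \sum_(i < m)
    (\1_[set w | decision pi (W w) x0 (D ^~ w) (S ^~ w) t = i] w *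
     supply_locations pi (W w) x0 (D ^~ w) (S ^~ w) t i)).
  apply: measurable_sum => i; apply: measurable_funM; last exact: measurable_supply.
  by apply: measurable_indic; apply: finite_valued_decision.
apply/funext => w; rewrite (bigD1 (decision pi (W w) x0 (D ^~ w) (S ^~ w) t)) //=.
rewrite indicE mem_set // mul1r big1 ?addr0 // => i ti.
by rewrite indicE memNset ?mul0r //= => E; rewrite E eqxx in ti.
Qed.

End measurable_dynamics.

(** * Independence *)

Section independence.
Context (d : measure_display) (Omega : measurableType d) (R : realType).
Variable P : probability Omega R.
Context (dU : measure_display) (U : measurableType dU) (N : nat).
Variables (W : {RV P >-> U}) (D S : nat -> {RV P >-> R}).
Hypothesis DSP : fully_dynamic_arrivals N W D S.

Let F := source_events (N := N) W D S.

Lemma source_preimage_W Y : measurable Y -> F None (W @^-1` Y).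
Proof. by move=> mY; exists Y => //; rewrite setTI. Qed.

Lemma source_preimage_D (t : 'I_N) Y : measurable Y -> F (Some (inl t)) (D t @^-1` Y).
Proof. by move=> mY; exists Y => //; rewrite setTI. Qed.

Lemma source_preimage_S (t : 'I_N) Y : measurable Y -> F (Some (inr t)) (S t @^-1` Y).
Proof. by move=> mY; exists Y => //; rewrite setTI. Qed.

Lemma sourceT j : F j setT.
Proof.
by case: j => [[t|t]|]; exists setT => //; rewrite setTI preimage_setT.
Qed.

Lemma sourceI j A B : F j A -> F j B -> F j (A `&` B).
Proof.
by case: j => [[t|t]|] [Y mY <-] [Z mZ <-]; exists (Y `&` Z);
  rewrite ?preimage_setI ?setTI //; exact: measurableI.
Qed.

Lemma source_measurable j A : F j A -> measurable A.
Proof.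
by case: j => [[t|t]|] [Y mY <-]; apply: measurable_funP.
Qed.

Definition past (t : nat) (j : option ('I_N + 'I_N)) : bool :=
  match j with
  | None => true
  | Some (inl s) => (s < t)%N
  | Some (inr s) => (s < t)%N
  end.

(** A pi-system generating the information available before period [t], seed included. *)
Definition past_boxes t : set (set Omega) :=
  [set B | exists2 A, (forall j, F j (A j)) & B = \bigcap_(j in [set j | past t j]) A j].

Lemma past_boxes_setI t : setI_closed (past_boxes t).
Proof.
move=> _ _ [A FA ->] [B FB ->]; exists (fun j => A j `&` B j).
  by move=> j; exact: sourceI.
by rewrite bigcapI.
Qed.

Lemma past_boxesT t : past_boxes t setT.
Proof.
exists (fun=> setT); first exact: sourceT.
by apply/seteqP; split.
Qed.

Lemma past_boxes_source t j A : past t j -> F j A -> past_boxes t A.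
Proof.
move=> pj FA; exists (fun k => if k == j then A else setT) => [k|].
  by case: eqP => [->|_] //; exact: sourceT.
apply/seteqP; split => [w Aw k _|w] /=; first by case: eqP.
by move=> /(_ j pj); rewrite eqxx.
Qed.

Lemma past_boxes_measurable t : past_boxes t `<=` measurable.
Proof.
move=> _ [A FA ->]; apply: fin_bigcap_measurable => [|j _]; first exact: finite_finset.
exact: source_measurable (FA j).
Qed.

Lemma past_boxes_indep (t : 'I_N) B X Y : past_boxes t B -> measurable X -> measurable Y ->
  P (B `&` (D t @^-1` X `&` S t @^-1` Y)) =
    (P B * (P (D t @^-1` X) * P (S t @^-1` Y)))%E.
Proof.
move=> [A FA ->] mX mY; have [_ _ indep] := DSP.
pose a : option ('I_N + 'I_N) := Some (inl t).
pose b : option ('I_N + 'I_N) := Some (inr t).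
pose J := [set j | past t j]%SET.
pose A' j := if j == a then D t @^-1` X else if j == b then S t @^-1` Y else A j.
have FA' j : F j (A' j).
  rewrite /A'; case: eqP => [->|_]; first exact: source_preimage_D.
  by case: eqP => [->|_]; [exact: source_preimage_S | exact: FA].
have aJ : a \notin b |: J by rewrite !inE /= ltnn.
have bJ : b \notin J by rewrite !inE /= ltnn.
have JE j : j \in J -> A' j = A j.
  rewrite /A' inE; case: eqP => [->|_]; first by rewrite /= ltnn.
  by case: eqP => [->|_] //; rewrite /= ltnn.
have H0 := indep J A (fun j _ => FA j).
have H1 := indep (a |: (b |: J)) A' (fun j _ => FA' j).
have -> : \bigcap_(j in [set j | past t j]) A j = \bigcap_(j in [set` J]) A j.
  by congr (\bigcap_(j in _) _); apply/seteqP; split => j /=; rewrite inE.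
rewrite H0.
move: H1; rewrite big_setU1 //= big_setU1 //= (eq_bigr (fun j => P (A j))); last first.
  by move=> j /JE ->.
have -> : A' a = D t @^-1` X by rewrite /A' eqxx.
have -> : A' b = S t @^-1` Y by rewrite /A' eqxx.
rewrite muleA muleC => <-; congr (P _); apply/seteqP; split => w /=.
  move=> [Aw [Dw Sw]] j /=; rewrite !inE => /orP[/eqP->|/orP[/eqP->|jJ]].
  - by rewrite /A' eqxx.
  - by rewrite /A' eqxx.
  - by rewrite JE ?inE //; apply: Aw; rewrite /= inE.
move=> H; split; last split.
- move=> j /= jJ.
  have jJ2 : j \in a |: (b |: J) by rewrite !in_setU1 jJ !orbT.
  have HA : A' j w := H j jJ2.
  by rewrite (JE _ jJ) in HA.
- have HA : A' a w by apply: H; rewrite /= !inE eqxx.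
  by rewrite /A' eqxx in HA.
- have HB : A' b w by apply: H; rewrite /= !inE eqxx orbT.
  by rewrite /A' eqxx in HB.
Qed.

(** Both sides are finite measures in [B], a restriction and a multiple of [P]; they agree on the
    pi-system [past_boxes t]. *)
Lemma past_indep (t : 'I_N) B X Y : <<s past_boxes t>> B -> measurable X -> measurable Y ->
  P (B `&` (D t @^-1` X `&` S t @^-1` Y)) =
    (P B * (P (D t @^-1` X) * P (S t @^-1` Y)))%E.
Proof.
move=> sB mX mY.
have mC : measurable (D t @^-1` X `&` S t @^-1` Y).
  apply: measurableI.
    exact: source_measurable (source_preimage_D _ mX).
  exact: source_measurable (source_preimage_S _ mY).
set C := _ `&` _ in mC *.
set q := (P (D t @^-1` X) * P (S t @^-1` Y))%E.
have q0 : (0 <= q)%E by rewrite mule_ge0.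
have qfin : q \is a fin_num by rewrite fin_numM // fin_num_measure //;
  [exact: source_measurable (source_preimage_D _ mX)
  |exact: source_measurable (source_preimage_S _ mY)].
pose r : {nonneg R} := NngNum (fine_ge0 q0).
rewrite -[P (B `&` C)]/(mrestr P mC B) muleC -[q]fineK //.
rewrite -[RHS]/(mscale r P B).
apply: (@g_sigma_algebra_measure_unique _ _ _ (past_boxes t) (@past_boxes_measurable t)
   (fun=> setT)) => //.
- by move=> _; exact: past_boxesT.
- by apply/seteqP; split => // w _; exists 0%N.
- exact: past_boxes_setI.
- move=> A GA; transitivity (P A * q)%E; first exact: past_boxes_indep.
  by rewrite -[q in LHS]fineK // muleC.
- move=> _; apply: (@le_lt_trans _ _ 1%E); last exact: ltry.
  by apply: probability_le1; exact: measurableI.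
Qed.

Variables (m : nat) (pi : policy U R m) (x0 : 'I_m -> R) (n : nat).

Let supply_cells (t : nat) (w : Omega) : {ffun 'I_m -> 'I_n.+1} :=
  [ffun i => cell n (supply_locations pi (W w) x0 (D ^~ w) (S ^~ w) t i)].

(** The measurability lemmas hold on any measurable space, so they apply to [Omega] with the
    sigma-algebra of the past. *)
Lemma supply_cells_past (t : 'I_N) a : <<s past_boxes t>> [set w | supply_cells t w = a].
Proof.
pose G := g_sigma_algebraType (past_boxes t).
have mG d' (V : measurableType d') (f : Omega -> V) j : past t j ->
    (forall Y, measurable Y -> F j (f @^-1` Y)) -> measurable_fun setT (f : G -> V).
  move=> pj Ff _ Y mY; rewrite setTI; apply: sub_sigma_algebra.
  by apply: (past_boxes_source pj); exact: Ff.
apply: (@finite_valued_cells _ _ _ _ pi x0 _ G (W : G -> U)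
  (fun s => D s : G -> R) (fun s => S s : G -> R)).
- by apply: (mG _ _ _ None) => //; exact: source_preimage_W.
- move=> s st; have sN := ltn_trans st (ltn_ord t).
  by apply: (mG _ _ _ (Some (inl (Ordinal sN)))) => // Y; exact: source_preimage_D.
- move=> s st; have sN := ltn_trans st (ltn_ord t).
  by apply: (mG _ _ _ (Some (inr (Ordinal sN)))) => // Y; exact: source_preimage_S.
Qed.

Let state t w := (supply_cells t w, (cell n (D t w), cell n (S t w))).

Lemma finite_valued_state t : finite_valued (state t).
Proof.
apply: finite_valued_pair; first exact: finite_valued_cells.
have cells (X : {RV P >-> R}) : finite_valued (fun w => cell n (X w)).
  move=> i; rewrite -[X in measurable X]setTI.
  exact: (measurable_funP X measurableT _ (measurable_cell i)).
exact: finite_valued_pair.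
Qed.

Lemma state_law (t : 'I_N) a i j : P [set w | state t w = (a, (i, j))] =
  (P [set w | supply_cells t w = a] * (n.+1%:R ^- 2)%:E)%E.
Proof.
have [uD uS _] := DSP.
have := past_indep (supply_cells_past a) (measurable_cell i) (measurable_cell j) (t := t).
have -> : P (D t @^-1` [set x | cell n x = i]) = (n.+1%:R^-1)%:E.
  by rewrite -(uniform_cell i); exact: (uD t (ltn_ord t) _ (measurable_cell i)).
have -> : P (S t @^-1` [set x | cell n x = j]) = (n.+1%:R^-1)%:E.
  by rewrite -(uniform_cell j); exact: (uS t (ltn_ord t) _ (measurable_cell j)).
rewrite -EFinM -expr2 exprVn => <-; congr (P _).
by apply/seteqP; split => w; [rewrite /state /= => -[<- [<- <-]] | case=> /= <- [<- <-]].
Qed.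

(** Given the supply cells, the pair of demand and arrival cells is uniform, so a bound on the
    average over pairs in every state passes to the mean. *)
Lemma expected_state_ge (t : 'I_N) (h : {ffun 'I_m -> 'I_n.+1} -> 'I_n.+1 -> 'I_n.+1 -> R)
    (c : R) : (forall a i j, 0 <= h a i j) ->
  (forall a, n.+1%:R ^+ 2 * c <= \sum_i \sum_j h a i j) ->
  (c%:E <= \int[P]_w (h (state t w).1 (state t w).2.1 (state t w).2.2)%:E)%E.
Proof.
move=> h0 hc.
rewrite (@integral_finite_valued _ _ _ P _ (state t)
  (fun v => h v.1 v.2.1 v.2.2)) //; last exact: finite_valued_state.
pose q a := fine (P [set w | supply_cells t w = a]).
have msc a : measurable [set w | supply_cells t w = a].
  exact: finite_valued_cells.
have qE a : P [set w | supply_cells t w = a] = (q a)%:E.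
  by rewrite fineK // fin_num_measure.
have q1 : \sum_a q a = 1.
  apply: EFin_inj; rewrite -sumEFin.
  have := @integral_finite_valued _ _ _ P _ (supply_cells t) (fun=> 1) msc (fun=> ler01).
  rewrite integral_cst //= probability_setT mule1 => ->.
  by apply: eq_bigr => a _; rewrite mul1e qE.
have -> : (\sum_y (h y.1 y.2.1 y.2.2)%:E * P [set w | state t w = y] =
    (\sum_a q a * (n.+1%:R ^- 2 * \sum_i \sum_j h a i j))%:E)%E.
  rewrite -sumEFin.
  under [RHS]eq_bigr => a _.
    rewrite pair_big /= mulr_sumr mulr_sumr -sumEFin; over.
  rewrite pair_big /=; apply: eq_bigr => -[a [i j]] _ /=.
  by rewrite state_law qE -!EFinM; congr EFin; ring.
rewrite lee_fin (_ : c = \sum_a q a * c); last by rewrite -mulr_suml q1 mul1r.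
apply: ler_sum => a _; rewrite ler_wpM2l ?fine_ge0 //.
by rewrite ler_pdivlMl ?hc // exprn_gt0 // ltr0n.
Qed.

Lemma expected_cost_ge (psi : {ffun 'I_m -> 'I_n.+1} -> 'I_n.+1 -> 'I_n.+1 -> R)
    (c K B : R) : (0 < N)%N -> 0 < B ->
  (forall a, n.+1%:R ^+ 2 * c <= \sum_i \sum_j psi a i j) ->
  (forall w, \sum_(t < N) psi (supply_cells t w) (cell n (D t w)) (cell n (S t w))
    <= K + B * \sum_(t < N) period_cost pi (W w) x0 (D ^~ w) (S ^~ w) t) ->
  (((c * N%:R - K) / (B * N%:R))%:E <=
    'E_P[fun w => average_cost pi (W w) x0 (D ^~ w) (S ^~ w) N])%E.
Proof.
move=> N0 B0 psic pathwise.
have N0' : 0 < N%:R :> R by rewrite ltr0n.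
pose f w := average_cost pi (W w) x0 (D ^~ w) (S ^~ w) N.
have f0 w : 0 <= f w by rewrite divr_ge0 // sumr_ge0 // => t _; exact: normr_ge0.
(* Shifting by [M] makes both sides nonnegative, as the integration rules for nonnegative functions
   require. *)
pose M : R := `|K| + \sum_a \sum_i \sum_j `|psi a i j|.
pose h a i j := psi a i j + M.
have h0 a i j : 0 <= h a i j.
  rewrite /h /M (bigD1 a) //= (bigD1 i) //= (bigD1 j) //=.
  have := ler_norm (- psi a i j); rewrite normrN.
  set s1 := \sum_(_ | _) _; set s2 := \sum_(_ | _) _; set s3 := \sum_(_ | _) _.
  have : 0 <= s1 by rewrite sumr_ge0.
  have : 0 <= s2 by rewrite sumr_ge0 // => *; rewrite sumr_ge0.
  have : 0 <= s3 by rewrite sumr_ge0 // => *; rewrite sumr_ge0 // => *; rewrite sumr_ge0.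
  have := normr_ge0 K; lra.
have hc a : n.+1%:R ^+ 2 * (c + M) <= \sum_i \sum_j h a i j.
  have -> : \sum_i \sum_j h a i j = \sum_i \sum_j psi a i j + n.+1%:R ^+ 2 * M.
    rewrite /h; under eq_bigr do rewrite big_split /= sumr_const card_ord.
    rewrite big_split /= sumr_const card_ord; congr (_ + _).
    by rewrite -[M *+ _]mulr_natl -[LHS]mulr_natl mulrA expr2.
  by rewrite mulrDr lerD2r.
have KM : 0 <= K + N%:R * M.
  have M0 : `|K| <= M.
    by rewrite lerDl !sumr_ge0 // => *; rewrite !sumr_ge0 // => *; rewrite sumr_ge0.
  have : `|K| <= N%:R * M.
    by rewrite (le_trans M0) // ler_peMl ?(le_trans _ M0) // ler1n.
  have := ler_norm (- K); rewrite normrN; lra.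
have mf : measurable_fun setT f by apply: measurable_average_cost.
have mh (t : 'I_N) : measurable_fun setT
    (fun w => (h (state t w).1 (state t w).2.1 (state t w).2.2)%:E).
  apply/measurable_EFinP => _ Y mY; rewrite setTI.
  rewrite (_ : _ @^-1` Y =
      [set w | [pred v | `[< Y (h v.1 v.2.1 v.2.2) >]] (state t w)]).
    exact: finite_valued_pred (@finite_valued_state t).
  by apply/seteqP; split => w /= /asboolP.
have h' (t : 'I_N) w : (0 <= (h (state t w).1 (state t w).2.1 (state t w).2.2)%:E)%E.
  by rewrite lee_fin.
have key : ((N%:R * (c + M))%:E <=
    (K + N%:R * M)%:E + (B * N%:R)%:E * \int[P]_w (f w)%:E)%E.
  apply: (@le_trans _ _ (\int[P]_w \sum_(t < N)
      (h (state t w).1 (state t w).2.1 (state t w).2.2)%:E)%E).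
    rewrite ge0_integral_sum //.
    have -> : (N%:R * (c + M))%:E = (\sum_(t < N) (c + M)%:E)%E.
      by rewrite sumEFin sumr_const card_ord mulr_natl.
    by apply: lee_sum => t _; exact: expected_state_ge.
  have mBf : measurable_fun setT (fun w => ((B * N%:R) * f w)%:E).
    by apply/measurable_EFinP; apply: measurable_funM => //; exact: measurable_cst.
  have BN0 : 0 <= B * N%:R by rewrite mulr_ge0 // ltW.
  apply: (@le_trans _ _ (\int[P]_w ((K + N%:R * M)%:E + ((B * N%:R) * f w)%:E))%E).
    apply: ge0_le_integral => //.
    - by move=> w _; apply: sume_ge0.
    - exact: emeasurable_sum.
    - by apply: emeasurable_funD => //; exact: measurable_cst.
    - move=> w _; rewrite sumEFin -EFinD lee_fin /h big_split /=.
      rewrite sumr_const card_ord -[M *+ N]mulr_natl.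
      have := pathwise w; rewrite /f /average_cost.
      have -> : B * N%:R * ((\sum_(t < N) period_cost pi (W w) x0 (D ^~ w) (S ^~ w) t) / N%:R) =
          B * \sum_(t < N) period_cost pi (W w) x0 (D ^~ w) (S ^~ w) t.
        by field; exact: lt0r_neq0.
      by rewrite /state /=; lra.
  have BNf w : (0 <= (B * N%:R * f w)%:E)%E by rewrite lee_fin mulr_ge0.
  rewrite ge0_integralD //.
  rewrite integral_cst //= probability_setT mule1 leeD2l //.
  under eq_integral do rewrite EFinM.
  rewrite ge0_integralZl_EFin //; last by apply/measurable_EFinP.
  by move=> w _; rewrite lee_fin.
rewrite unlock -/f; move: key.
case: (\int[P]_w (f w)%:E)%E => [r| |] /=.
- rewrite -EFinM -EFinD !lee_fin => key; rewrite ler_pdivrMr ?mulr_gt0 //; lra.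
- by move=> _; exact: leey.
- by rewrite gt0_muleNy ?lte_fin ?mulr_gt0 // addeNy leeNy_eq.
Qed.

End independence.

(** * Drift of the supply profile *)

Section counts.
Context {R : realType}.

Lemma sum_step_right n i : (i < n)%N -> \sum_(x < n) step i x = n%:R - i.+1%:R :> R.
Proof.
move=> ni; have E x : step i x = 1 - step x i.+1 :> R.
  by rewrite /step ltnS ltnNge; case: (x <= i)%N; rewrite ?subrr ?subr0.
under eq_bigr do rewrite E.
by rewrite sumrB sum_step // sumr_const card_ord.
Qed.

Lemma step_L1 n i j : (i < n)%N -> (j < n)%N ->
  \sum_(x < n) `|step i x - step j x| <= `|i%:R - j%:R| :> R.
Proof.
wlog ij : i j / (i <= j)%N.
  move=> H ni nj; have [ij|/ltnW ji] := leqP i j; first exact: H.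
  under eq_bigr do rewrite distrC.
  by rewrite distrC; exact: H.
move=> ni nj.
have E x : `|step i x - step j x| = step i x - step j x :> R.
  rewrite ger0_norm // subr_ge0 /step ler_nat.
  by case: (ltnP j x) => // jx; rewrite (leq_ltn_trans ij jx).
under eq_bigr do rewrite E.
rewrite sumrB !sum_step_right // distrC ger0_norm ?subr_ge0 ?ler_nat //.
by rewrite -(natr1 i) -(natr1 j); lra.
Qed.

Definition counts m n (a : {ffun 'I_m -> 'I_n}) (x : nat) : R :=
  \sum_(i < m) step (a i) x.

Lemma counts_box m n (a : {ffun 'I_m -> 'I_n}) : box n m%:R (counts a).
Proof.
split.
- by rewrite /counts big1.
- rewrite /counts (eq_bigr (fun=> 1)) => [|i _]; last by rewrite /step ltn_ord.
  by rewrite sumr_const card_ord.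
- move=> x _; rewrite /counts; apply/andP; split; first by apply: sumr_ge0.
  rewrite (@le_trans _ _ (\sum_(i < m) (1 : R))) //.
    by apply: ler_sum => i _; rewrite /step; case: (_ < _)%N; rewrite ?ler01 ?lexx.
  by rewrite sumr_const card_ord.
Qed.

Lemma counts_mono m n (a : {ffun 'I_m -> 'I_n}) x : counts a x <= counts a x.+1.
Proof.
apply: ler_sum => i _; rewrite /step ler_nat.
by case: (ltnP (a i) x) => // ix; rewrite ltnS (ltnW ix).
Qed.

End counts.

Section pathwise.
Context (dU : measure_display) (U : measurableType dU) (R : realType) (m n : nat).
Variables (pi : policy U R m) (u : U) (x0 : 'I_m -> R) (D S : nat -> R).

Let locations := supply_locations pi u x0 D S.
Let cells t : {ffun 'I_m -> 'I_n.+1} := [ffun i => cell n (locations t i)].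
Let matched t := decision pi u x0 D S t.
Let cost := period_cost pi u x0 D S.

Lemma demand_cell_dist t :
  `|(cells t (matched t))%:R - (cell n (D t))%:R| <= n.+1%:R * cost t + 1 :> R.
Proof.
rewrite ffunE (le_trans (cell_dist _ _ _)) // lerD2r ler_wpM2l // distrC.
exact: lexx.
Qed.

Lemma counts_succ t x : counts (cells t.+1) x =
  counts (cells t) x + step (cell n (S t)) x - step (cells t (matched t)) x :> R.
Proof.
rewrite /counts (bigD1 (matched t)) //= [in RHS](bigD1 (matched t)) //=.
rewrite [cells t.+1 _]ffunE /locations /= eqxx.
rewrite (eq_bigr (fun i => step (cells t i) x)); last first.
  by move=> i it; rewrite !ffunE /locations /= (negbTE it).
ring.
Qed.

(** The profile after demand and arrival differs from the next one by two steps, at the matched and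
    at the demand cell, whose l1 distance the cost controls. The rest telescopes. *)
Lemma potential_drift (Phi : (nat -> R) -> R) N :
  (forall F G, Phi F <= Phi G + 64 * \sum_(x < n.+1) `|F x - G x|) ->
  \sum_(t < N) (Phi (fun x => counts (cells t) x + step (cell n (S t)) x
                               - step (cell n (D t)) x) - Phi (counts (cells t)))
  <= 64 * (n.+1%:R * m%:R + N%:R) + 64 * n.+1%:R * \sum_(t < N) cost t.
Proof.
move=> lip.
have one t : Phi (fun x => counts (cells t) x + step (cell n (S t)) x
      - step (cell n (D t)) x) - Phi (counts (cells t)) <=
    (Phi (counts (cells t.+1)) - Phi (counts (cells t))) + 64
     + 64 * n.+1%:R * cost t.
  have := lip (fun x => counts (cells t) x + step (cell n (S t)) x
      - step (cell n (D t)) x) (counts (cells t.+1)).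
  have -> : \sum_(x < n.+1) `|counts (cells t) x + step (cell n (S t)) x
      - step (cell n (D t)) x - counts (cells t.+1) x| =
      \sum_(x < n.+1) `|step (cells t (matched t)) x - step (cell n (D t)) x| :> R.
    by apply: eq_bigr => x _; rewrite counts_succ; congr `|_|; ring.
  have := @step_L1 R _ _ _ (ltn_ord (cells t (matched t))) (ltn_ord (cell n (D t))).
  have := demand_cell_dist t; lra.
apply: le_trans (ler_sum _ (fun (t : 'I_N) _ => one t)) _.
rewrite big_split /= big_split /= -mulr_sumr sumr_const card_ord -[64 *+ N]mulr_natr.
rewrite -(big_mkord xpredT (fun t => Phi (counts (cells t.+1)) - Phi (counts (cells t)))).
rewrite telescope_sumr //.
have : \sum_(x < n.+1) `|counts (cells N) x - counts (cells 0) x| <= n.+1%:R * m%:R :> R.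
  have -> : n.+1%:R * m%:R = \sum_(x < n.+1) (m%:R : R).
    by rewrite sumr_const card_ord -[RHS]mulr_natl.
  apply: ler_sum => x _.
  have [_ _ /(_ x (ltnW (ltn_ord x)))/andP[a1 a2]] := @counts_box R _ _ (cells N).
  have [_ _ /(_ x (ltnW (ltn_ord x)))/andP[b1 b2]] := @counts_box R _ _ (cells 0).
  by rewrite ler_norml; apply/andP; split; lra.
have := lip (counts (cells N)) (counts (cells 0)); lra.
Qed.

(** Adjacent cells are excluded too, since they contain arbitrarily close points. *)
Definition isolated (a : {ffun 'I_m -> 'I_n.+1}) (i : 'I_n.+1) : bool :=
  [forall k, (i.+1 < a k)%N || ((a k).+1 < i)%N].

Lemma isolated_cost t : (isolated (cells t) (cell n (D t)))%:R <= n.+1%:R * cost t.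
Proof.
have c0 : 0 <= n.+1%:R * cost t by rewrite mulr_ge0 // normr_ge0.
case: (boolP (isolated _ _)) => [/forallP/(_ (matched t))|_] //=.
have := demand_cell_dist t; set a := cells t (matched t); set i := cell n (D t).
move=> h far; suff : 2 <= `|a%:R - i%:R| :> R by move=> h2; lra.
case/orP: far => [ia|ai].
  have : i.+2%:R <= a%:R :> R by rewrite ler_nat.
  rewrite -(natr1 i.+1) -(natr1 i) => h2; apply: le_trans (ler_norm _); lra.
have : a.+2%:R <= i%:R :> R by rewrite ler_nat.
rewrite -(natr1 a.+1) -(natr1 a) => h2; rewrite distrC; apply: le_trans (ler_norm _); lra.
Qed.

End pathwise.

Lemma sum_eq_le1 n k : (\sum_(i < n) (i == k :> nat) <= 1)%N.
Proof.
have [kn|nk] := ltnP k n.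
  rewrite (bigD1 (Ordinal kn)) //= eqxx big1 // => i ik.
  by case: eqP => // E; case/eqP: ik; exact/val_inj.
by rewrite big1 // => i _; case: eqP => // ik; have := ltn_ord i; lia.
Qed.

(** Each supply unit spoils at most its own cell and the two neighbours. *)
Lemma isolated_count m n (a : {ffun 'I_m -> 'I_n.+1}) :
  (n.+1 <= \sum_(i < n.+1) isolated a i + 3 * m)%N.
Proof.
have near i : (1 <= isolated a i +
    \sum_(k < m) ((i == a k :> nat) + (i == (a k).-1 :> nat) + (i == (a k).+1 :> nat)))%N.
  case: (boolP (isolated a i)) => [_|]; first by rewrite add1n.
  rewrite negb_forall => /existsP[k]; rewrite negb_or -!leqNgt => /andP[h1 h2].
  by rewrite (bigD1 k) //=; lia.
have total : (\sum_(i < n.+1) 1 <= \sum_(i < n.+1) (isolated a i +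
    \sum_(k < m) ((i == a k :> nat) + (i == (a k).-1 :> nat) + (i == (a k).+1 :> nat))))%N.
  by apply: leq_sum => i _; exact: near.
rewrite sum1_card card_ord in total; apply: leq_trans total _.
rewrite big_split leq_add2l /= exchange_big /=.
have -> : (3 * m)%N = (\sum_(k < m) 3)%N by rewrite sum_nat_const card_ord mulnC.
apply: leq_sum => k _; rewrite !big_split /=.
by rewrite -[3%N]/(1 + 1 + 1)%N !leq_add ?sum_eq_le1.
Qed.

(** * The two lower bounds on the expected cost *)

Section bounds.
Context (d : measure_display) (Omega : measurableType d) (R : realType).
Variable P : probability Omega R.
Context (dU : measure_display) (U : measurableType dU).

(** With four cells per supply unit, at least a quarter of the cells are isolated, and a demand
    there costs at least one cell width. *)
Lemma expected_cost_isolated N m (pi : policy U R m.+1) x0 (W : {RV P >-> U})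
    (D S : nat -> {RV P >-> R}) : (0 < N)%N -> fully_dynamic_arrivals N W D S ->
  (((16 * m.+1%:R)^-1)%:E <=
    'E_P[fun w => average_cost pi (W w) x0 (D ^~ w) (S ^~ w) N])%E.
Proof.
move=> N0 DSP.
have E4 : (4 * m.+1)%:R = 4 * m.+1%:R :> R by rewrite natrM.
have En : (4 * m + 3).+1 = (4 * m.+1)%N by lia.
have := @expected_cost_ge _ _ _ P _ _ N W D S DSP _ pi x0 (4 * m + 3)
  (fun a i _ => (isolated a i)%:R) 4^-1 0 (4 * m.+1%:R) N0.
have m0 : 0 < m.+1%:R :> R by rewrite ltr0n.
have N0' : 0 < N%:R :> R by rewrite ltr0n.
have -> : (4^-1 * N%:R - 0) / (4 * m.+1%:R * N%:R) = (16 * m.+1%:R)^-1 :> R.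
  by field; rewrite ?lt0r_neq0.
apply; first by rewrite mulr_gt0.
- move=> a; pose s := (\sum_i isolated a i)%N.
  have -> : \sum_i \sum_(j < (4 * m + 3).+1) (isolated a i)%:R =
      (4 * m + 3).+1%:R * s%:R :> R.
    rewrite /s natr_sum mulr_sumr; apply: eq_bigr => i _.
    by rewrite sumr_const card_ord mulr_natl.
  have ms : m.+1%:R <= s%:R :> R.
    by rewrite ler_nat; have := isolated_count a; rewrite -/s; lia.
  have nE : (4 * m + 3).+1%:R = 4 * m.+1%:R :> R by rewrite En E4.
  rewrite expr2 -mulrA ler_wpM2l // nE; lra.
- move=> w; rewrite add0r mulr_sumr; apply: ler_sum => t _.
  by rewrite -E4 -En; exact: isolated_cost.
Qed.

Lemma expected_cost_ln N m (pi : policy U R m.+1) x0 (W : {RV P >-> U})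
    (D S : nat -> {RV P >-> R}) : (m.+1 ^ 2 <= N)%N -> fully_dynamic_arrivals N W D S ->
  ((((ln m.+1%:R - ln 8 - 1) / 128 - 128) / (64 * m.+1%:R))%:E <=
    'E_P[fun w => average_cost pi (W w) x0 (D ^~ w) (S ^~ w) N])%E.
Proof.
move=> mN DSP; have N0 : (0 < N)%N by rewrite (leq_trans _ mN) // expn_gt0.
have m0 : 0 < m.+1%:R :> R by rewrite ltr0n.
have N0' : 0 < N%:R :> R by rewrite ltr0n.
pose T := (m.+1 %/ 8)%N.
have [Phi [lip gain]] := @potential R m.+1 T isT ltac:(rewrite /T; lia).
have := @expected_cost_ge _ _ _ P _ _ N W D S DSP _ pi x0 m
  (fun a i j => Phi (fun x => counts a x + step j x - step i x) - Phi (counts a))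
  ((harm T - 1) / 128) (64 * (m.+1%:R * m.+1%:R + N%:R)) (64 * m.+1%:R) N0.
move=> H; apply: le_trans (H _ _ _).
- rewrite lee_fin ler_pdivlMr ?mulr_gt0 //.
  have ln_le : ln m.+1%:R - ln 8 <= harm T :> R.
    apply: le_trans (harm_ge_ln T); rewrite lerBlDl -lnM ?posrE ?ltr0n //.
    rewrite ler_ln ?posrE ?mulr_gt0 ?ltr0n //.
    by rewrite -natrM ler_nat /T; lia.
  (* Here the horizon pays for the total variation of the potential, which costs at most 64 per
     period on top of the 64 from rounding to cells. *)
  have mN' : m.+1%:R * m.+1%:R <= N%:R :> R.
    by rewrite -natrM ler_nat -mulnn in mN *.
  have -> : ((ln m.+1%:R - ln 8 - 1) / 128 - 128) / (64 * m.+1%:R) * (64 * m.+1%:R * N%:R) =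
      ((ln m.+1%:R - ln 8 - 1) / 128 - 128) * N%:R :> R.
    by field; exact: lt0r_neq0.
  have : (ln m.+1%:R - ln 8) * N%:R <= harm T * N%:R :> R by rewrite ler_wpM2r.
  by lra.
- by rewrite mulr_gt0.
- move=> a; have := gain _ (@counts_box R _ _ a) (fun x _ => counts_mono a x).
  have -> : \sum_(i < m.+1) \sum_(j < m.+1) (Phi (fun x => counts a x + step j x - step i x)
      - Phi (counts a)) = \sum_(i < m.+1) \sum_(j < m.+1)
      Phi (fun x => counts a x + step j x - step i x) - m.+1%:R ^+ 2 * Phi (counts a).
    have E : m.+1%:R ^+ 2 * Phi (counts a) =
        \sum_(i < m.+1) \sum_(j < m.+1) Phi (counts a).
      rewrite !sumr_const !card_ord -[RHS]mulr_natl -[Phi _ *+ _]mulr_natl.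
      by rewrite expr2 mulrA.
    by rewrite E -sumrB; apply: eq_bigr => i _; rewrite sumrB.
  by lra.
- by move=> w; exact: potential_drift.
Qed.

End bounds.

Theorem theorem3 (R : realType) :
  exists2 eps : R, 0 < eps &
    forall (m N : nat), (2 <= m)%N -> (m ^ 2 <= N)%N ->
    forall x0 : 'I_m -> R, (forall i, 0 <= x0 i <= 1) ->
    forall (dU : measure_display) (U : measurableType dU) (pi : policy U R m)
           (d : measure_display) (Omega : measurableType d)
           (P : probability Omega R)
           (W : {RV P >-> U}) (D S : nat -> {RV P >-> R}),
      fully_dynamic_arrivals N W D S ->
      ((eps * (ln m%:R / m%:R))%:E <=
        'E_P[fun w => average_cost pi (W w) x0 (D ^~ w) (S ^~ w) N])%E.
Proof.
(* From [ln m = L] on, the numerator in [expected_cost_ln] is at least [ln m / 256]; below [L],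
   [expected_cost_isolated] suffices with the constant [(16 * L)^-1]. *)
pose L : R := 2 * (ln 8 + 1) + 128 * 256.
have ln8 : 0 <= ln 8 :> R by rewrite ln_ge0 // ler1n.
have L0 : 0 < L by rewrite /L; lra.
pose eps : R := Num.min ((64^-1 / 256)) ((16 * L)^-1).
have eps1 : eps <= (64^-1 / 256) by rewrite ge_min lexx.
have eps2 : eps <= (16 * L)^-1 by rewrite ge_min lexx orbT.
have e0 : 0 < 64^-1 / 256 :> R by rewrite divr_gt0 // invr_gt0.
have e1 : 0 < (16 * L)^-1 by rewrite invr_gt0 mulr_gt0.
exists eps; first by rewrite lt_min e0 e1.
case=> [//|m] N m2 mN x0 _ dU U pi d Omega P W D S DSP.
have N0 : (0 < N)%N by rewrite (leq_trans _ mN) // expn_gt0.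
have m0 : 0 < m.+1%:R :> R by rewrite ltr0n.
have lnm : 0 <= ln m.+1%:R :> R by rewrite ln_ge0 // ler1n.
have [lt|ge] := ltP (ln m.+1%:R) L.
  apply: le_trans (expected_cost_isolated pi x0 N0 DSP).
  rewrite lee_fin invfM mulrA ler_wpM2r ?invr_ge0 //.
  apply: (@le_trans _ _ ((16 * L)^-1 * L)); last first.
    by rewrite invfM mulfVK // lt0r_neq0.
  by apply: ler_pM => //; [rewrite le_min (ltW e0) (ltW e1) | exact: ltW].
apply: le_trans (expected_cost_ln pi x0 mN DSP).
rewrite lee_fin invfM !mulrA ler_wpM2r ?invr_ge0 //.
apply: (@le_trans _ _ ((64^-1 / 256) * ln m.+1%:R)); first by rewrite ler_wpM2r.
rewrite /L in ge; lra.
Qed.
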